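(* Let $\mathcal{N}$ be a finite-dimensional complex $d$-locally diagonalizable nilpotent Lie superalgebra. Then there exists a unique maximal solvable extension of $\mathcal{N}$, up to isomorphism, that satisfies an analogue of Lie's theorem. Moreover, this extension is isomorphic to a solvable Lie superalgebra of the form $\mathcal{R}_{\mathcal{T}}=\mathcal{N}\rtimes\mathcal{T}$, where $\mathcal{T}$ is a maximal torus on $\mathcal{N}$.
   Context: All vector spaces and (super)algebras are finite-dimensional over $\mathbb{C}$. Unless otherwise noted, solvable (super)algebras are assumed non-nilpotent, and nilpotent ones are assumed not characteristically nilpotent. Lie superalgebras $\mathcal{L}=\mathcal{L}_0\oplus\mathcal{L}_1$ are $\mathbb{Z}_2$-graded with the usual super-skew-symmetry and Jacobi superidentity. $\operatorname{Der}(\mathcal{L})_0$ is the Lie algebra of even superderivations (degree-preserving linear maps $d$ with $d([x,y])=[d(x),y]+[x,d(y)]$). The convention $\operatorname{ad}_x(y)=[y,x]$ is used. Analogue of Lie's theorem: all solvable Lie superalgebras $\mathcal{R}=\mathcal{R}_0\oplus\mathcal{R}_1$ considered as extensions are required to satisfy $[\mathcal{R}_1,\mathcal{R}_1]\subseteq[\mathcal{R}_0,\mathcal{R}_0]$; this condition is equivalent to the validity of the analogue of Lie's theorem for $\mathcal{R}$, and ''satisfies an analogue of Lie's theorem'' means this condition. Torus: a torus on a Lie superalgebra $\mathcal{L}$ is an abelian subalgebra of $\operatorname{Der}(\mathcal{L})_0$ consisting of diagonalizable endomorphisms; it is maximal if it is not strictly contained in another torus. For a maximal torus $\mathcal{T}$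 on a nilpotent Lie superalgebra $\mathcal{N}$ and $\alpha\in\mathcal{T}^*$, put $\mathcal{N}_\alpha=\{n\in\mathcal{N} : t(n)=\alpha(t)n\ \forall t\in\mathcal{T}\}$ (root subspace) and $W=\{\alpha\in\mathcal{T}^* : \mathcal{N}_\alpha\neq0\}$, so $\mathcal{N}=\bigoplus_{\alpha\in W}\mathcal{N}_\alpha$. Nil-independence: even superderivations $d_1,\dots,d_s$ of $\mathcal{N}$ are nil-independent if $\sum_{i=1}^s c_id_i$ is non-nilpotent for all scalars $c_1,\dots,c_s\in\mathbb{C}$ that are not all zero. Maximal solvable extension: a solvable extension of $\mathcal{N}$ is a solvable Lie superalgebra $\mathcal{R}=\mathcal{N}\oplus\mathcal{Q}$ (direct sum of vector spaces) whose nilradical is $\mathcal{N}$, with $\mathcal{Q}$ a complementary subspace (for $\mathcal{R}$ satisfying the condition above it is known that $\mathcal{Q}\subseteq\mathcal{R}_0$ and $\operatorname{ad}_x|_{\mathcal{N}}$ is a non-nilpotent even superderivation for every nonzero $x\in\mathcal{Q}$). It is maximal if $\dim\mathcal{Q}$ is maximal. $d$-locally diagonalizable: one fixes a basis of $\mathcal{N}$ in which all nil-independent even superderivations are simultaneously represented by upper-triangular matrices (it is assumed a priori that they have this form). The diagonal of a derivation is the diagonal part of its matrix in this basis. $\mathcal{N}$ is called $d$-locally diagonalizable if: (i) the diagonals of all nil-independent even superderivations generate a maximal torus $\mathcal{T}$ on $\mathcal{N}$; (ii) for each root subspace $\mathcal{N}_\alpha$ with respect to $\mathcal{T}$, the restriction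 to $\mathcal{N}_\alpha$ followed by projection onto $\mathcal{N}_\alpha$ (along the other root subspaces) of every nil-independent even superderivation is diagonal; (iii) $0\notin W$. $\mathcal{R}_{\mathcal{T}}$: for a torus $\mathcal{T}$ on $\mathcal{N}$, $\mathcal{R}_{\mathcal{T}}=\mathcal{N}\rtimes\mathcal{T}$ is the solvable Lie superalgebra on $\mathcal{N}\oplus\mathcal{T}$ ($\mathcal{T}$ even) in which $\mathcal{N}$ keeps its bracket, $[n,t]=t(n)$ for $n\in\mathcal{N}$, $t\in\mathcal{T}$, and $[\mathcal{T},\mathcal{T}]=0$. *)

(* Defs.v *)
From HB Require Import structures.
From mathcomp Require Import all_boot all_order all_algebra.
From mathcomp Require Import all_reals.
From mathcomp Require Import complex.
From mathcomp Require Import ring.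

Set Implicit Arguments.
Unset Strict Implicit.
Unset Printing Implicit Defensive.

Import Order.TTheory GRing.Theory Num.Theory.
Local Open Scope ring_scope.

(* Degrees are booleans: [false] is even, [true] is odd.  The last field is   *)
(* the Jacobi superidentity, saying that [x, -] is a superderivation.         *)
Record lieSuperalgebra (F : numClosedFieldType) := LieSuperalgebra {
  ls_space :> vectType F;
  ls_grade : bool -> {vspace ls_space};
  ls_br : ls_space -> ls_space -> ls_space;
  ls_gradeD : (ls_grade false + ls_grade true)%VS = fullv;
  ls_gradeI : (ls_grade false :&: ls_grade true)%VS = 0%VS;
  ls_br_linr : forall x, linear (ls_br x);
  ls_br_linl : forall y, linear (ls_br^~ y);
  ls_br_grade : forall a b x y, x \in ls_grade a -> y \in ls_grade b ->
    ls_br x y \in ls_grade (a (+) b);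
  ls_skew : forall a b x y, x \in ls_grade a -> y \in ls_grade b ->
    ls_br x y = - ((-1) ^+ (a && b) *: ls_br y x);
  ls_jacobi : forall a b c x y z,
    x \in ls_grade a -> y \in ls_grade b -> z \in ls_grade c ->
    ls_br x (ls_br y z) =
      ls_br (ls_br x y) z + (-1) ^+ (a && b) *: ls_br y (ls_br x z) }.

Section Subspaces.
Context {F : numClosedFieldType} (L : lieSuperalgebra F).
Implicit Types (x y : L) (U V I : {vspace L}).

(* The span of all [u, v] with u in U and v in V; see [memv_brv], [brvP]. *)
Definition brv U V : {vspace L} :=
  <<[seq ls_br u v | u <- vbasis U, v <- vbasis V]>>%VS.

HB.instance Definition _ x :=
  GRing.isLinear.Build F L L *:%R (ls_br x) (ls_br_linr x).

Lemma memv_brv U V x y : x \in U -> y \in V -> ls_br x y \in brv U V.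
Proof.
move=> Ux Vy; pose brl v (u : L) := ls_br u v.
pose Brl v : {linear L -> L} :=
  HB.pack (brl v) (GRing.isLinear.Build F L L *:%R (brl v) (ls_br_linl v)).
rewrite (coord_vbasis Vy) linear_sum; apply: memv_suml => j _.
rewrite linearZ memvZ //= (coord_vbasis Ux) -[ls_br _ _]/(Brl _ _) linear_sum.
apply: memv_suml => i _; rewrite linearZ memvZ //=; apply: memv_span.
by apply: allpairs_f; apply: mem_nth; rewrite size_tuple.
Qed.

Lemma brvP U V I :
  reflect (forall u v, u \in U -> v \in V -> ls_br u v \in I) (brv U V <= I)%VS.
Proof.
apply: (iffP idP) => [sUVI u v Uu Vv | sUVI].
  exact/(subvP sUVI)/memv_brv.
apply/span_subvP=> _ /allpairsP[[u v] /= [Uu Vv ->]].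
by apply: sUVI; apply: vbasis_mem.
Qed.

Fixpoint lower_central U (k : nat) : {vspace L} :=
  if k is k'.+1 then brv (lower_central U k') U else U.

Fixpoint derived_series U (k : nat) : {vspace L} :=
  if k is k'.+1 then brv (derived_series U k') (derived_series U k') else U.

Definition nilpotent_sub U : Prop := exists k, lower_central U k = 0%VS.

Definition nilpotent_ls : Prop := nilpotent_sub fullv.

Definition solvable_ls : Prop := exists k, derived_series fullv k = 0%VS.

Definition graded_sub U : Prop :=
  U = (U :&: ls_grade L false + U :&: ls_grade L true)%VS.

Definition ideal I : Prop := graded_sub I /\ (brv I fullv <= I)%VS.

Definition nilradical I : Prop :=
  [/\ ideal I, nilpotent_sub I &
      forall J, ideal J -> nilpotent_sub J -> (J <= I)%VS].

(* The condition equivalent to the analogue of Lie's theorem. *)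
Definition lie_theorem_condition : Prop :=
  (brv (ls_grade L true) (ls_grade L true)
     <= brv (ls_grade L false) (ls_grade L false))%VS.

End Subspaces.

Arguments nilpotent_ls {F} L.
Arguments solvable_ls {F} L.
Arguments lie_theorem_condition {F} L.

Section Morphisms.
Context {F : numClosedFieldType}.
Implicit Types L M : lieSuperalgebra F.

Definition ls_hom L M (f : 'Hom(L, M)) : Prop :=
  (forall b, (f @: ls_grade L b <= ls_grade M b)%VS) /\
  (forall x y, f (ls_br x y) = ls_br (f x) (f y)).

Definition isomorphic L M : Prop :=
  exists f : 'Hom(L, M), [/\ ls_hom f, lker f = 0%VS & limg f = fullv].

End Morphisms.

Section Derivations.
Context {F : numClosedFieldType} (N : lieSuperalgebra F).
Implicit Types (d t : 'End(N)) (T : {vspace 'End(N)}).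

Definition even_superder d : Prop :=
  (forall b, (d @: ls_grade N b <= ls_grade N b)%VS) /\
  (forall x y, d (ls_br x y) = ls_br (d x) y + ls_br x (d y)).

Definition nilpotent_end d : Prop := exists k, forall x, iter k d x = 0.

Definition diagonalizable_end d : Prop :=
  exists e : (\dim {:N}).-tuple N,
    basis_of fullv e /\ forall i, exists c, d e`_i = c *: e`_i.

Definition characteristically_nilpotent : Prop :=
  forall d, even_superder d -> nilpotent_end d.

(* A commutative subspace of endomorphisms is an abelian Lie subalgebra. *)
Definition torus T : Prop :=
  [/\ forall t, t \in T -> even_superder t,
      forall s t, s \in T -> t \in T -> (s \o t = t \o s)%VF &
      forall t, t \in T -> diagonalizable_end t].

Definition maximal_torus T : Prop :=
  torus T /\ forall T', torus T' -> (T <= T')%VS -> T' = T.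

Definition in_root_space T (alpha : 'Hom(subvs_of T, F^o)) (n : N) : Prop :=
  forall t : subvs_of T, vsval t n = (alpha t : F) *: n.

Definition root T (alpha : 'Hom(subvs_of T, F^o)) : Prop :=
  exists2 n : N, n != 0 & in_root_space alpha n.

(* p is the projection onto the root subspace of alpha along the others. *)
Definition root_projection T (alpha : 'Hom(subvs_of T, F^o)) (p : 'End(N)) :=
  (forall n, in_root_space alpha n -> p n = n) /\
  (forall (beta : 'Hom(subvs_of T, F^o)) n,
     beta != alpha -> in_root_space beta n -> p n = 0).

Definition nil_independent s (ds : 'I_s -> 'End(N)) : Prop :=
  (forall i, even_superder (ds i)) /\
  (forall c : 'I_s -> F, (exists i, c i != 0) ->
     ~ nilpotent_end (\sum_(i < s) c i *: ds i)).

(* d is one of "the nil-independent even superderivations": it is a member of *)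
(* some nil-independent family.                                               *)
Definition nil_independent_der d : Prop :=
  exists s (ds : 'I_s -> 'End(N)), nil_independent ds /\ exists i, ds i = d.

Section Diagonal.
Variable e : (\dim {:N}).-tuple N.

(* Column convention: the (j, i) entry of d is the e_j-coordinate of d e_i. *)
Definition upper_triangular d : Prop :=
  forall i j : 'I_(\dim {:N}), (i < j)%N -> coord e j (d e`_i) = 0.

Definition diagonal_part d : 'End(N) :=
  linfun (fun x : N =>
    \sum_(i < \dim {:N}) (coord e i x * coord e i (d e`_i)) *: e`_i).

Lemma diagonal_partE d x :
  diagonal_part d x =
    \sum_(i < \dim {:N}) (coord e i x * coord e i (d e`_i)) *: e`_i.
Proof.
pose f (x : N) :=
  \sum_(i < \dim {:N}) (coord e i x * coord e i (d e`_i)) *: e`_i.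
have lf : linear f.
  move=> a u v; rewrite /f scaler_sumr -big_split; apply: eq_bigr => i _ /=.
  by rewrite linearD linearZ mulrDl scalerDl scalerA mulrA.
pose lin : {linear N -> N} :=
  HB.pack f (GRing.isLinear.Build F N N *:%R f lf).
exact: (lfunE lin).
Qed.

End Diagonal.

(* The diagonals commute, so the subalgebra they generate is their span.  In  *)
(* clause (ii), once (i) holds every e_i is a root vector, so those lying in  *)
(* a root subspace form a basis of it.                                        *)
Definition d_locally_diagonalizable : Prop :=
  exists (e : (\dim {:N}).-tuple N) (T : {vspace 'End(N)}),
    [/\ basis_of fullv e /\
          (forall d, nil_independent_der d -> upper_triangular e d),
        maximal_torus T /\
          [/\ forall d, nil_independent_der d -> diagonal_part e d \in T &
              forall U : {vspace 'End(N)},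
                (forall d, nil_independent_der d -> diagonal_part e d \in U) ->
                (T <= U)%VS],
        forall (alpha : 'Hom(subvs_of T, F^o)) (p d : 'End(N)),
          root alpha -> root_projection alpha p -> nil_independent_der d ->
          forall i : 'I_(\dim {:N}), in_root_space alpha e`_i ->
            exists c, p (d e`_i) = c *: e`_i &
        ~ root (0 : 'Hom(subvs_of T, F^o))].

End Derivations.

Arguments characteristically_nilpotent {F} N.
Arguments d_locally_diagonalizable {F} N.

Section Extensions.
Context {F : numClosedFieldType} (N : lieSuperalgebra F).

(* R = N + Q, where N is identified with its image under iota.  All solvable  *)
(* extensions are required to be non-nilpotent and to satisfy the condition   *)
(* for the analogue of Lie's theorem.                                         *)
Definition solvable_extension (R : lieSuperalgebra F) (iota : 'Hom(N, R))
    (Q : {vspace R}) : Prop :=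
  [/\ [/\ solvable_ls R, ~ nilpotent_ls R & lie_theorem_condition R],
      ls_hom iota /\ lker iota = 0%VS,
      nilradical (limg iota) &
      (limg iota + Q)%VS = fullv /\ (limg iota :&: Q)%VS = 0%VS].

Definition maximal_solvable_extension (R : lieSuperalgebra F) : Prop :=
  exists (iota : 'Hom(N, R)) (Q : {vspace R}),
    solvable_extension iota Q /\
    forall (R' : lieSuperalgebra F) (iota' : 'Hom(N, R')) (Q' : {vspace R'}),
      solvable_extension iota' Q' -> (\dim Q' <= \dim Q)%N.

End Extensions.

Section Semidirect.
Context {F : numClosedFieldType} (N : lieSuperalgebra F).
Variables (T : {vspace 'End(N)}) (hT : torus T).

Local Notation S := (N * subvs_of T)%type.

Definition sd_inl (n : N) : S := (n, 0).
Definition sd_inr (t : subvs_of T) : S := (0, t).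

Fact sd_inl_linear : linear sd_inl.
Proof. by move=> a u v; congr pair; rewrite /= scaler0 addr0. Qed.
HB.instance Definition _ :=
  GRing.isLinear.Build F N S *:%R sd_inl sd_inl_linear.

Fact sd_inr_linear : linear sd_inr.
Proof. by move=> a u v; congr pair; rewrite /= scaler0 addr0. Qed.
HB.instance Definition _ :=
  GRing.isLinear.Build F (subvs_of T) S *:%R sd_inr sd_inr_linear.

Definition sd_grade (b : bool) : {vspace S} :=
  (linfun sd_inl @: ls_grade N b
     + (if b then 0 else linfun sd_inr @: fullv))%VS.

(* [n, t] = t(n), hence [t, n] = - t(n) since t is even, and [t, s] = 0. *)
Definition sd_br (x y : S) : S :=
  (ls_br x.1 y.1 + vsval y.2 x.1 - vsval x.2 y.1, 0).

Lemma sd_gradeP b (x : S) :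
  x \in sd_grade b <-> x.1 \in ls_grade N b /\ (b -> x.2 = 0).
Proof.
split=> [/memv_addP[_ /memv_imgP[n Nn ->] [v hv ->]]|].
  rewrite lfunE; case: b Nn hv => Nn.
    by rewrite memv0 => /eqP->; rewrite addr0.
  by case/memv_imgP=> t _ ->; rewrite lfunE /= addr0.
case: x => n t /= [Nn ht].
have -> : (n, t) = linfun sd_inl n + linfun sd_inr t.
  by rewrite !lfunE; congr pair; rewrite /= ?addr0 ?add0r.
apply: memv_add; first exact: memv_img.
case: b Nn ht => _; first by move=> ->//; rewrite linear0 mem0v.
by move=> _; apply/memv_img/memvf.
Qed.

Fact sd_gradeD : (sd_grade false + sd_grade true)%VS = fullv.
Proof.
apply/eqP; rewrite eqEsubv subvf; apply/subvP=> -[n t] _.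
have: n \in (ls_grade N false + ls_grade N true)%VS.
  by rewrite ls_gradeD memvf.
case/memv_addP=> n0 h0 [n1 h1 ->].
have -> : (n0 + n1, t) = (n0, t) + (n1, 0) :> S.
  by congr pair; rewrite /= addr0.
by apply: memv_add; apply/sd_gradeP.
Qed.

Fact sd_gradeI : (sd_grade false :&: sd_grade true)%VS = 0%VS.
Proof.
apply/eqP; rewrite -subv0; apply/subvP=> -[n t].
rewrite memv_cap => /andP[/sd_gradeP[/= n0 _] /sd_gradeP[/= n1 /(_ isT) ->]].
have: n \in (ls_grade N false :&: ls_grade N true)%VS by rewrite memv_cap n0.
by rewrite ls_gradeI !memv0 => /eqP->.
Qed.

Let brDr (x y z : N) : ls_br x (y + z) = ls_br x y + ls_br x z.
Proof. by have := ls_br_linr x 1 y z; rewrite !scale1r. Qed.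

Let brDl (x y z : N) : ls_br (x + y) z = ls_br x z + ls_br y z.
Proof. by have := ls_br_linl z 1 x y; rewrite !scale1r. Qed.

Let br0r (x : N) : ls_br x 0 = 0.
Proof. by apply: (addrI (ls_br x 0)); rewrite -brDr !addr0. Qed.

Let br0l (x : N) : ls_br 0 x = 0.
Proof. by apply: (addrI (ls_br 0 x)); rewrite -brDl !addr0. Qed.

Let brNr (x y : N) : ls_br x (- y) = - ls_br x y.
Proof. by apply: (addrI (ls_br x y)); rewrite -brDr !subrr br0r. Qed.

Let brNl (x y : N) : ls_br (- x) y = - ls_br x y.
Proof. by apply: (addrI (ls_br x y)); rewrite -brDl !subrr br0l. Qed.

Let vect_eq (x y : N) :
  (forall i, coord (vbasis fullv) i x = coord (vbasis fullv) i y) -> x = y.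
Proof.
move=> exy; rewrite (coord_vbasis (memvf x)) (coord_vbasis (memvf y)).
by apply: eq_bigr => i _; rewrite exy.
Qed.

(* Linear identities in N, checked on coordinates by [ring]. *)
Ltac vect_ring :=
  apply: vect_eq => ?; rewrite ?(linearD, linearN, linearZ) /=; ring.

Fact sd_br_linr x : linear (sd_br x).
Proof.
move=> a y z; congr pair; last by rewrite /= scaler0 addr0.
rewrite /= ls_br_linr !(linearD, linearZ) /= !lfun_simp.
vect_ring.
Qed.

Fact sd_br_linl y : linear (sd_br^~ y).
Proof.
move=> a x z; congr pair; last by rewrite /= scaler0 addr0.
rewrite /= ls_br_linl !(linearD, linearZ) /= !lfun_simp.
vect_ring.
Qed.

Let torus_grade (t : subvs_of T) b n :
  n \in ls_grade N b -> vsval t n \in ls_grade N b.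
Proof.
move=> Nn; have [hd _ _] := hT; have [+ _] := hd _ (subvsP t).
by move/(_ b)/subvP; apply; apply: memv_img.
Qed.

Let torus_der (t : subvs_of T) x y :
  vsval t (ls_br x y) = ls_br (vsval t x) y + ls_br x (vsval t y).
Proof. by have [hd _ _] := hT; have [_ ->] := hd _ (subvsP t). Qed.

Let torus_comm (s t : subvs_of T) x : vsval s (vsval t x) = vsval t (vsval s x).
Proof.
have [_ hc _] := hT; have /lfunP/(_ x) := hc _ _ (subvsP s) (subvsP t).
by rewrite !comp_lfunE.
Qed.

Fact sd_br_grade a b x y : x \in sd_grade a -> y \in sd_grade b ->
  sd_br x y \in sd_grade (a (+) b).
Proof.
case: x y => [n t] [m s] /sd_gradeP[/= hn ht] /sd_gradeP[/= hm hs].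
apply/sd_gradeP; split=> //=; apply: rpredB; first apply: rpredD.
- exact: ls_br_grade.
- case: b hm hs => hm hs; first by rewrite hs // lfunE mem0v.
  by rewrite addbF torus_grade.
- case: a hn ht => hn ht; first by rewrite ht // lfunE mem0v.
  by rewrite torus_grade.
Qed.

Fact sd_skew a b x y : x \in sd_grade a -> y \in sd_grade b ->
  sd_br x y = - ((-1) ^+ (a && b) *: sd_br y x).
Proof.
case: x y => [n t] [m s] /sd_gradeP[/= hn ht] /sd_gradeP[/= hm hs].
congr pair; last by rewrite /= scaler0 oppr0.
rewrite /= (ls_skew hn hm).
case: (boolP (a && b)) => [/andP[ha hb]|_] /=.
  by rewrite ht // hs // !lfunE /=; vect_ring.
by rewrite expr0; vect_ring.
Qed.

Fact sd_jacobi a b c x y z :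
  x \in sd_grade a -> y \in sd_grade b -> z \in sd_grade c ->
  sd_br x (sd_br y z) =
    sd_br (sd_br x y) z + (-1) ^+ (a && b) *: sd_br y (sd_br x z).
Proof.
case: x y z => [n t] [m s] [k r].
move=> /sd_gradeP[/= hn ht] /sd_gradeP[/= hm hs] /sd_gradeP[/= hk _].
congr pair; last by rewrite /= scaler0 addr0.
rewrite /= !(brDl, brDr, brNl, brNr) (ls_jacobi hn hm hk).
rewrite !(linearD, linearN) /= !torus_der !(zero_lfunE, linear0).
rewrite (torus_comm t r m) (torus_comm s r n) (torus_comm s t k).
rewrite (ls_skew (torus_grade r hn) hm).
case: (boolP (a && b)) => [/andP[ha hb]|_] /=.
  rewrite ht // hs // !(zero_lfunE, linear0, br0l, br0r) /=.
  by vect_ring.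
by rewrite expr0; vect_ring.
Qed.

Definition semidirect : lieSuperalgebra F :=
  LieSuperalgebra sd_gradeD sd_gradeI sd_br_linr sd_br_linl
    sd_br_grade sd_skew sd_jacobi.

End Semidirect.

(* Main.v *)
(* Write N = (+) N_a for the root decomposition under the torus T spanned by  *)
(* the diagonals.  The hypotheses make every even superderivation of N upper  *)
(* triangular with diagonal in T, and T its own centralizer in Der(N)_0.      *)
(* Let R be an extension.  Sending x in R_0 to the diagonal of ad_x on N is a *)
(* homomorphism to T with kernel H, and an Engel argument shows that the      *)
(* ideal H + R_1 lies in the nilradical N: this is where solvability and      *)
(* [R_1, R_1] <= [R_0, R_0] are used.  Hence dim Q <= dim T, with equality    *)
(* for N x| T.  In case of equality pick x in R_0 with diagonal t0 generic in *)
(* T.  As no root vanishes at t0, the centralizer C of x in R_0 is an abelian *)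
(* complement of N.  As ad t0 is invertible on the strictly triangular        *)
(* derivations, successive exponentials conjugate ad_x to t0; they then       *)
(* conjugate the derivations ad_c, c in C, into the centralizer of T, i.e.    *)
(* into T itself, whence an isomorphism of R with N x| T.                     *)
Require Import Defs.
From HB Require Import structures.
From mathcomp Require Import all_boot all_order all_algebra.
From mathcomp Require Import all_reals boolp.
From mathcomp Require Import complex ring zify.

Set Implicit Arguments.
Unset Strict Implicit.
Unset Printing Implicit Defensive.

Import Order.TTheory GRing.Theory Num.Theory.
Local Open Scope ring_scope.

(** * Linear algebra *)

(** An extension [L] of [N] is read through the triangular matrices by which its even part acts on
    [N]. The diagonal of [adN x] is a Lie homomorphism from the even part to the torus [T], since
    diagonals of commutators of triangular matrices vanish. Its kernel together with the odd part is
    an ideal, and descending along the derived series of that ideal, with [engel_nilpotent] at each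
    stage, places it inside the nilradical ([odd_in_nilradical], [even_in_nilradical]). A complement
    of [N] thus has as dimension the rank of the diagonal map, at most [\dim T]
    ([dim_extension_le]), and [sd_extension] attains the bound.

    For full rank, [adapted_exists] supplies [t0] in [T] at which no root vanishes and distinct
    roots differ. Its centralizer among the even superderivations lies in [T]
    ([commuting_in_torus]), and every even superderivation with diagonal [t0] is conjugate to [t0]
    under an automorphism of [N] ([conj_to_torus]). If [x0] is an even element with diagonal [t0],
    its even centralizer is an abelian complement of [N]; the automorphism [g] taking [adN x0] to
    [t0] takes the action of this complement, which commutes with [adN x0], into [T]. Then [g] on
    [N] and this identification with [T] glue to the isomorphism of [extension_isomorphic]. *)

Lemma linfunE (F : fieldType) (U V : vectType F) (f : U -> V) :
  linear f -> linfun f =1 f.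
Proof.
move=> lf; pose g : {linear U -> V} :=
  HB.pack f (GRing.isLinear.Build F U V *:%R f lf).
exact: (lfunE g).
Qed.

Lemma poly0_nat (F : numFieldType) (p : {poly F}) :
  (forall k : nat, p.[k.+1%:R] = 0) -> p = 0.
Proof.
move=> p0; apply/eqP/contraT => pn0.
have := max_poly_roots (rs := [seq k.+1%:R | k <- iota 0 (size p)]) pn0.
rewrite size_map size_iota ltnn map_inj_uniq ?iota_uniq; last first.
  by move=> a b /eqP /[!eqr_nat] /eqP[].
by move=> /(_ _ isT) -> //; apply/allP=> _ /mapP[k _ ->]; apply/eqP/p0.
Qed.

Section VectorSpaces.
Context {F : numFieldType} {V : vectType F}.
Implicit Types (u v x : V) (d s t : 'End(V)).

(** Linear conditions on endomorphisms are stated as propositions; as subspaces they become open to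
    dimension counts. *)
Lemma vspace_of_pred (P : V -> Prop) :
  P 0 -> (forall a u v, P u -> P v -> P (a *: u + v)) ->
  exists U : {vspace V}, forall v, v \in U <-> P v.
Proof.
move=> P0 PD.
suff grow m (U : {vspace V}) : (forall v, v \in U -> P v) ->
    (\dim {:V} <= \dim U + m)%N ->
    exists U : {vspace V}, forall v, v \in U <-> P v.
  apply: (grow (\dim {:V}) 0%VS); last by rewrite leq_addl.
  by move=> v /[!memv0] /eqP->.
elim: m U => [|m IHm] U UP leU.
  exists U => v; split=> [/UP//|_].
  suff -> : U = fullv by rewrite memvf.
  by apply/eqP; rewrite eqEdim subvf; rewrite addn0 in leU.
have [PU|/existsNP[v /not_implyP[Pv /negP vU]]] :=
  EM (forall v, P v -> v \in U).
  by exists U => v; split=> [/UP|/PU].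
apply: (IHm (<[v]> + U)%VS) => [_ /memv_addP[_ /vlineP[a ->] [w /UP Pw ->]]|].
  exact: PD.
have : (\dim U < \dim (<[v]> + U))%N.
  rewrite ltn_neqAle dimvS ?addvSr // andbT; apply: contra vU => /eqP eqd.
  have /eqP -> : U == (<[v]> + U)%VS by rewrite eqEdim addvSr eqd leqnn.
  by rewrite memvE addvSl.
lia.
Qed.

(* Along a line [c w + u], each of finitely many nonzero functionals vanishes *)
(* at most once.                                                              *)
Lemma generic_vector (U : {vspace V}) (I : finType) (f : I -> V -> F) :
  (forall i a u v, f i (a *: u + v) = a * f i u + f i v) ->
  exists2 u, u \in U &
    forall i, (exists2 v, v \in U & f i v != 0) -> f i u != 0.
Proof.
move=> fD; suff [u uU fu] : exists2 u, u \in U & forall i, i \in enum I ->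
    (exists2 v, v \in U & f i v != 0) -> f i u != 0.
  by exists u => // i; apply: fu; rewrite mem_enum.
elim: (enum I) => [|i s [u uU fu]]; first by exists 0; rewrite ?mem0v.
have [[w wU fw]|fi0] := EM (exists2 w, w \in U & f i w != 0); last first.
  by exists u => // j /predU1P[-> /fi0//|]; apply: fu.
pose s' := i :: [seq j <- s | f j u != 0].
have [k fk] : exists k : nat, \prod_(j <- s') f j (k.+1%:R *: w + u) != 0.
  apply/not_existsP => f0.
  suff p0 : \prod_(j <- s') (f j w *: 'X + (f j u)%:P) != 0.
    apply/(negP p0)/eqP/poly0_nat => k; rewrite horner_prod.
    have /negP/negPn/eqP <- := f0 k.
    by apply: eq_bigr => j _; rewrite fD !hornerE mulrC.
  rewrite prodf_seq_neq0; apply/allP=> j; rewrite inE mem_filter.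
  case/predU1P=> [->|/andP[fj _]] /=.
    apply: contra fw => /eqP/polyP/(_ 1%N).
    by rewrite !coefE mulr1 addr0 => ->.
  apply: contra fj => /eqP/polyP/(_ 0%N).
  by rewrite !coefE mulr0 add0r => ->.
exists (k.+1%:R *: w + u) => [|j]; first by rewrite rpredD ?rpredZ.
move: fk; rewrite prodf_seq_neq0 => /allP/= fk; rewrite inE => js fj.
apply: fk; rewrite inE mem_filter; case/predU1P: js => [->|js].
  by rewrite eqxx.
by rewrite js fu ?orbT.
Qed.

(** The images of the powers of [d] shrink strictly until they are stationary, and nilpotency leaves
    0 as the only stationary value. A uniform exponent makes nilpotency a polynomial condition on
    [d]. *)
Lemma nilpotent_iter_dim d x :
  (exists k, forall x, iter k d x = 0) -> iter (\dim {:V}) d x = 0.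
Proof.
case=> m dm; pose W k := iter k (fun U => d @: U)%VS fullv.
have WS k : (W k.+1 <= W k)%VS.
  by elim: k => [|k IHk]; rewrite ?subvf //= limgS.
have W0 : W m = 0%VS.
  suff Wx k y : y \in W k -> exists z, y = iter k d z.
    apply/eqP; rewrite -subv0; apply/subvP=> y /Wx[z ->].
    by rewrite dm mem0v.
  elim: k y => [|k IHk] y /=; first by exists y.
  by case/memv_imgP=> _ /IHk[z ->] ->; exists z.
have Wdim k : W k = 0%VS \/ (\dim (W k) + k <= \dim {:V})%N.
  elim: k => [|k [IHk|IHk]]; first by right; rewrite addn0.
    by left; rewrite /= -/(W k) IHk limg0.
  have [eqW|neW] := eqVneq (W k.+1) (W k).
    left; rewrite eqW -W0.
    have Wk j : W (j + k)%N = W k.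
      by elim: j => [//|j /= IHj]; rewrite -/(W (j + k)%N) IHj.
    have [lemk|/ltnW lekm] := leqP k m; first by rewrite -(subnK lemk) Wk.
    apply/eqP; rewrite eqEsubv W0 sub0v andbT -(subnK lekm) -W0.
    elim: (k - m)%N => [//|j]; apply: subv_trans; exact: WS.
  right; have : (\dim (W k.+1) < \dim (W k))%N.
    rewrite ltn_neqAle dimvS // andbT; apply: contra neW.
    by rewrite eqEdim WS => /eqP->/=.
  lia.
have mW k : iter k d x \in W k.
  by elim: k => [|k IHk]; rewrite ?memvf //= memv_img.
suff Wd0 : W (\dim {:V}) = 0%VS.
  by have := mW (\dim {:V}); rewrite Wd0 memv0 => /eqP.
case: (Wdim (\dim {:V})) => // lewd; apply/eqP; rewrite -dimv_eq0; lia.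
Qed.
End VectorSpaces.

(** * Triangular endomorphisms in a fixed basis *)

Section Bases.
Context {F : numFieldType} {V : vectType F} {n : nat} (e : n.-tuple V).
Hypothesis eB : basis_of fullv e.
Implicit Types (x y : V) (d u v : 'End(V)) (i j : 'I_n).

Lemma basis_expand x : x = \sum_i coord e i x *: e`_i.
Proof. exact: (coord_basis eB (memvf x)). Qed.

Lemma basis_coord i j : coord e j e`_i = (i == j)%:R.
Proof. by rewrite coord_free // (basis_free eB). Qed.

Lemma coord_eq x y : (forall i, coord e i x = coord e i y) -> x = y.
Proof.
move=> exy; rewrite (basis_expand x) (basis_expand y).
by apply: eq_bigr => i _; rewrite exy.
Qed.

Lemma coord_lfun j d x :
  coord e j (d x) = \sum_i coord e i x * coord e j (d e`_i).
Proof.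
rewrite {1}(basis_expand x) !linear_sum; apply: eq_bigr => i _.
by rewrite !linearZ.
Qed.

Lemma lfun_basis_eq d u :
  (forall i j, coord e j (d e`_i) = coord e j (u e`_i)) -> d = u.
Proof.
move=> edu; apply/lfunP=> x; apply: coord_eq => j.
by rewrite !coord_lfun; apply: eq_bigr => i _; rewrite edu.
Qed.

(** A nonzero entry lies at least [k] places above the diagonal: level 0 is upper triangular, level
    1 strictly so. Levels add under composition ([below_comp]). *)
Definition below k d := forall i j, (i < j + k)%N -> coord e j (d e`_i) = 0.

Lemma belowW k l d : (l <= k)%N -> below k d -> below l d.
Proof.
by move=> lk dk i j ij; apply/dk/(leq_trans ij); rewrite leq_add2l.
Qed.

Lemma below_lin k a d u : below k d -> below k u -> below k (a *: d + u).
Proof.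
move=> dk uk i j ij; rewrite !lfun_simp linearD linearZ /= dk // uk //.
by rewrite mulr0 addr0.
Qed.

Lemma below0 k : below k 0.
Proof. by move=> i j _; rewrite zero_lfunE linear0. Qed.

Lemma belowD k d u : below k d -> below k u -> below k (d + u).
Proof. by move=> dk uk; rewrite -[d]scale1r; apply: below_lin. Qed.

Lemma belowZ k a d : below k d -> below k (a *: d).
Proof. by move=> dk; rewrite -[_ *: _]addr0; apply/below_lin/below0. Qed.

Lemma belowB k d u : below k d -> below k u -> below k (d - u).
Proof.
by move=> dk uk; rewrite addrC -scaleN1r; apply: below_lin.
Qed.

Lemma below_comp k l d u : below k d -> below l u -> below (k + l) (d \o u)%VF.
Proof.
move=> dk ul i j ij; rewrite comp_lfunE coord_lfun big1 // => m _.
have [lim|lim] := ltnP i (m + l); first by rewrite ul ?mul0r.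
by rewrite dk ?mulr0 //; lia.
Qed.

Lemma below_ge k d : (n <= k)%N -> below k d -> d = 0.
Proof.
move=> nk dk; apply: lfun_basis_eq => i j.
by rewrite dk ?zero_lfunE ?linear0 //; have := ltn_ord i; lia.
Qed.

Lemma below1_nilpotent d : below 1 d -> forall x, iter n d x = 0.
Proof.
move=> d1 x.
suff H k j : (n < j.+1 + k)%N -> coord e j (iter k d x) = 0.
  by apply: coord_eq => j; rewrite H ?linear0 //; lia.
elim: k j => [|k IHk] j lj; first by have := ltn_ord j; lia.
rewrite iterS coord_lfun big1 // => i _.
have [ij|ij] := ltnP i (j + 1); first by rewrite d1 ?mulr0.
by rewrite IHk ?mul0r //; lia.
Qed.

Lemma coord_iter_diag d k i : below 0 d ->
  coord e i (iter k d e`_i) = coord e i (d e`_i) ^+ k.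
Proof.
move=> d0.
suff [_ dk] : (forall j, (i < j)%N -> coord e j (iter k d e`_i) = 0) /\
    coord e i (iter k d e`_i) = coord e i (d e`_i) ^+ k by [].
elim: k => [|k [IH0 IH1]] /=.
  by split=> [j ij|]; rewrite basis_coord ?eqxx // -val_eqE ltn_eqF.
split=> [j ij|]; rewrite coord_lfun.
  rewrite big1 // => l _; have [il|li] := ltnP i l; first by rewrite IH0 ?mul0r.
  by rewrite d0 ?mulr0 // addn0; lia.
rewrite (bigD1 i) //= IH1 exprSr big1 ?addr0 // => l.
rewrite -val_eqE neq_ltn => /orP[li|il]; last by rewrite IH0 ?mul0r.
by rewrite d0 ?mulr0 // addn0.
Qed.

(** Back substitution: the coordinates of a kernel vector vanish one after the other, starting from
    the last. *)
Lemma below0_inj d : below 0 d -> (forall i, coord e i (d e`_i) != 0) ->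
  lker d == 0%VS.
Proof.
move=> d0 dd; rewrite -subv0; apply/subvP=> x; rewrite memv_ker memv0.
move=> /eqP dx; apply/eqP/coord_eq => j; rewrite linear0.
have [m lm] := ubnP (n - j); elim: m => [|m IHm] in j lm *; first by [].
have := congr1 (coord e j) dx.
rewrite coord_lfun linear0 (bigD1 j) //= big1 ?addr0 => [/eqP|i].
  by rewrite mulf_eq0 (negPf (dd j)) orbF => /eqP.
rewrite -val_eqE neq_ltn => /orP[ij|ji]; first by rewrite d0 ?mulr0 // addn0.
by rewrite IHm ?mul0r //; have := ltn_ord i; move: ji lm => /=; lia.
Qed.

End Bases.

(** * Ideals of Lie superalgebras *)

Section Brackets.
Context {F : numClosedFieldType}.

(* The operator ad_y in the right-handed convention ad_y(x) = [x, y]. *)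
Definition ad {L : lieSuperalgebra F} (y : L) : 'End(L) :=
  linfun (fun x : L => ls_br x y).

Context {L : lieSuperalgebra F}.
Implicit Types (x y z : L) (U V W A B I J : {vspace L}) (a b : bool).

Lemma brDl x y z : ls_br (x + y) z = ls_br x z + ls_br y z.
Proof. by have := ls_br_linl z 1 x y; rewrite !scale1r. Qed.

Lemma brDr x y z : ls_br z (x + y) = ls_br z x + ls_br z y.
Proof. exact: linearD. Qed.

Lemma adE y x : ad y x = ls_br x y.
Proof. exact: (linfunE (ls_br_linl y)). Qed.

Lemma brZl k x y : ls_br (k *: x) y = k *: ls_br x y.
Proof. by rewrite -!adE linearZ. Qed.

Lemma br0l y : ls_br 0 y = 0.
Proof. by rewrite -adE linear0. Qed.

Lemma brNl x y : ls_br (- x) y = - ls_br x y.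
Proof. by rewrite -!adE linearN. Qed.

Lemma homogeneous_split x : exists x0 x1,
  [/\ x0 \in ls_grade L false, x1 \in ls_grade L true & x = x0 + x1].
Proof.
have : x \in (ls_grade L false + ls_grade L true)%VS.
  by rewrite ls_gradeD memvf.
by case/memv_addP=> x0 ? [x1 ? ->]; exists x0, x1.
Qed.

Lemma grade_disjoint x :
  x \in ls_grade L false -> x \in ls_grade L true -> x = 0.
Proof.
move=> x0 x1; apply/eqP; rewrite -memv0 -(ls_gradeI L).
by rewrite memv_cap x0 x1.
Qed.

Lemma br_evenC x y : x \in ls_grade L false -> ls_br y x = - ls_br x y.
Proof.
move=> x0; have [y0 [y1 [Ly0 Ly1 ->]]] := homogeneous_split y.
rewrite brDl brDr opprD (ls_skew x0 Ly0) (ls_skew x0 Ly1) /= expr0 !scale1r.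
by rewrite !opprK.
Qed.

Lemma ad_even_der y x z : y \in ls_grade L false ->
  ls_br (ls_br x z) y = ls_br (ls_br x y) z + ls_br x (ls_br z y).
Proof.
move=> y0; rewrite (br_evenC _ y0) (br_evenC x y0) (br_evenC z y0).
rewrite brNl linearN /= -opprD; congr (- _).
have key a x' z' : x' \in ls_grade L a ->
    ls_br y (ls_br x' z') = ls_br (ls_br y x') z' + ls_br x' (ls_br y z').
  have [z0 [z1 [Lz0 Lz1 ->]]] := homogeneous_split z' => Lx.
  rewrite !brDr (ls_jacobi y0 Lx Lz0) (ls_jacobi y0 Lx Lz1) /=.
  by rewrite expr0 !scale1r addrACA.
have [x0 [x1 [Lx0 Lx1 ->]]] := homogeneous_split x.
by rewrite !(brDl, brDr) (key _ _ _ Lx0) (key _ _ _ Lx1) addrACA.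
Qed.

Lemma brvS U V U' V' :
  (U <= U')%VS -> (V <= V')%VS -> (brv U V <= brv U' V')%VS.
Proof.
move=> /subvP sU /subvP sV; apply/brvP=> u v Uu Vv.
by apply: memv_brv; [apply: sU | apply: sV].
Qed.

Lemma graded_split U x : graded_sub U -> x \in U -> exists x0 x1,
  [/\ x0 \in U, x0 \in ls_grade L false, x1 \in U, x1 \in ls_grade L true &
      x = x0 + x1].
Proof.
move=> gU; rewrite {1}gU => /memv_addP[x0 + [x1 + ->]].
by rewrite !memv_cap => /andP[? ?] /andP[? ?]; exists x0, x1.
Qed.

Lemma graded_intro U :
  (forall x, x \in U -> exists x0 x1, [/\ x0 \in U, x0 \in ls_grade L false,
     x1 \in U, x1 \in ls_grade L true & x = x0 + x1]) -> graded_sub U.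
Proof.
move=> gU; apply/eqP; rewrite eqEsubv subv_add !capvSl /= andbT.
apply/subvP=> x /gU[x0 [x1 [Ux0 Lx0 Ux1 Lx1 ->]]].
by apply: memv_add; rewrite memv_cap ?Ux0 ?Ux1.
Qed.

Lemma graded_full : graded_sub (fullv : {vspace L}).
Proof. by rewrite /graded_sub !capfv ls_gradeD. Qed.

Lemma graded_add U V : graded_sub U -> graded_sub V -> graded_sub (U + V).
Proof.
move=> gU gV; apply: graded_intro => _ /memv_addP[u Uu [v Vv ->]].
have [u0 [u1 [? ? ? ? ->]]] := graded_split gU Uu.
have [v0 [v1 [? ? ? ? ->]]] := graded_split gV Vv.
exists (u0 + v0), (u1 + v1); split; last exact: addrACA.
- exact: memv_add.
- exact: rpredD.
- exact: memv_add.
- exact: rpredD.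
Qed.

Lemma graded_ad_img U x b : graded_sub U -> x \in ls_grade L b ->
  graded_sub (ad x @: U).
Proof.
move=> gU Lx; apply: graded_intro => _ /memv_imgP[u Uu ->].
have [u0 [u1 [U0 L0 U1 L1 ->]]] := graded_split gU Uu.
rewrite linearD /=; have B0 := ls_br_grade L0 Lx; have B1 := ls_br_grade L1 Lx.
case: b Lx B0 B1 => Lx B0 B1.
  exists (ad x u1), (ad x u0); split; rewrite ?memv_img ?adE //.
  by rewrite addrC.
by exists (ad x u0), (ad x u1); split; rewrite ?memv_img ?adE.
Qed.

Lemma graded_brv U V : graded_sub U -> graded_sub V -> graded_sub (brv U V).
Proof.
move=> gU gV; have memB a b u v : u \in U -> v \in V ->
    u \in ls_grade L a -> v \in ls_grade L b ->
    ls_br u v \in (brv U V :&: ls_grade L false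
                   + brv U V :&: ls_grade L true)%VS.
  move=> Uu Vv Lu Lv; have := ls_br_grade Lu Lv; have := memv_brv Uu Vv.
  case: (a (+) b) => Buv Luv.
    by apply/(subvP (addvSr _ _)); rewrite memv_cap Buv.
  by apply/(subvP (addvSl _ _)); rewrite memv_cap Buv.
apply/eqP; rewrite eqEsubv subv_add !capvSl /= andbT.
apply/brvP=> u v /(graded_split gU)[u0 [u1 [? ? ? ? ->]]].
case/(graded_split gV)=> v0 [v1 [? ? ? ? ->]].
by rewrite !(brDl, brDr) !rpredD //; apply: memB; eassumption.
Qed.

Lemma ideal_brr I x y : ideal I -> x \in I -> ls_br x y \in I.
Proof. by case=> _ /brvP sI Ix; apply: sI; rewrite ?memvf. Qed.

(** [ideal] asks for stability on one side only; the other side follows from super-skew-symmetry on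
    homogeneous components, which exist in [I] because it is graded. *)
Lemma ideal_brl I x y : ideal I -> y \in I -> ls_br x y \in I.
Proof.
move=> idI; case: (idI) => gI _ /(graded_split gI)[y0 [y1 [I0 L0 I1 L1 ->]]].
have [x0 [x1 [Lx0 Lx1 ->]]] := homogeneous_split x.
rewrite !(brDl, brDr) !rpredD //.
- by rewrite (ls_skew Lx0 L0) rpredN rpredZ // ideal_brr.
- by rewrite (ls_skew Lx0 L1) rpredN rpredZ // ideal_brr.
- by rewrite (ls_skew Lx1 L0) rpredN rpredZ // ideal_brr.
- by rewrite (ls_skew Lx1 L1) rpredN rpredZ // ideal_brr.
Qed.

Lemma br_brC a b c x y z :
  x \in ls_grade L a -> y \in ls_grade L b -> z \in ls_grade L c ->
  ls_br (ls_br x y) z =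
    ls_br x (ls_br y z) - (-1) ^+ (a && b) *: ls_br y (ls_br x z).
Proof. by move=> Lx Ly Lz; rewrite (ls_jacobi Lx Ly Lz) addrK. Qed.

Lemma ideal_full : ideal (fullv : {vspace L}).
Proof. by split; [exact: graded_full | exact: subvf]. Qed.

Lemma ideal_brv I J : ideal I -> ideal J -> ideal (brv I J).
Proof.
move=> idI idJ; have [gI _] := idI; have [gJ _] := idJ.
split; first exact: graded_brv.
apply/brvP=> x z xIJ _; rewrite -adE.
suff /subvP/(_ x xIJ) : (brv I J <= ad z @^-1: brv I J)%VS.
  by rewrite -memv_preim.
apply/brvP=> u v Iu Jv; rewrite -memv_preim adE.
have [z0 [z1 [Lz0 Lz1 ->]]] := homogeneous_split z.
have [u0 [u1 [U0 Lu0 U1 Lu1 ->]]] := graded_split gI Iu.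
have [v0 [v1 [V0 Lv0 V1 Lv1 ->]]] := graded_split gJ Jv.
have memB a b c x' y' z' : x' \in I -> y' \in J -> x' \in ls_grade L a ->
    y' \in ls_grade L b -> z' \in ls_grade L c ->
    ls_br (ls_br x' y') z' \in brv I J.
  move=> Ix Jy Lx Ly Lz; rewrite (br_brC Lx Ly Lz) rpredB ?rpredZ //.
    by apply: memv_brv => //; apply: ideal_brr.
  have Lxz := ls_br_grade Lx Lz.
  rewrite (ls_skew Ly Lxz) rpredN rpredZ //.
  by apply: memv_brv => //; apply: ideal_brr.
by rewrite !(brDl, brDr) !rpredD //; apply: memB; eassumption.
Qed.

Lemma ideal_add I J : ideal I -> ideal J -> ideal (I + J).
Proof.
move=> idI idJ; have [gI _] := idI; have [gJ _] := idJ.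
split; first exact: graded_add.
apply/brvP=> _ v /memv_addP[x Ix [y Jy ->]] _.
by rewrite brDl memv_add ?ideal_brr.
Qed.

Lemma ideal_derived I k : ideal I -> ideal (derived_series I k).
Proof. by move=> idI; elim: k => //= k IHk; apply: ideal_brv. Qed.

Lemma ideal_lower I k : ideal I -> ideal (lower_central I k).
Proof. by move=> idI; elim: k => //= k IHk; apply: ideal_brv. Qed.

Lemma derived_seriesS U V k :
  (U <= V)%VS -> (derived_series U k <= derived_series V k)%VS.
Proof. by move=> sUV; elim: k => //= k IHk; apply: brvS. Qed.

Lemma derived_lower U k :
  (brv U U <= U)%VS -> (derived_series U k <= lower_central U k)%VS.
Proof.
move=> sU; have DU j : (derived_series U j <= U)%VS.
  by elim: j => //= j IHj; apply: subv_trans sU; apply: brvS.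
by elim: k => //= k IHk; apply: brvS.
Qed.

Lemma graded_line x b : x \in ls_grade L b -> graded_sub <[x]>.
Proof.
move=> Lx; apply: graded_intro => _ /vlineP[k ->].
case: b Lx => Lx.
  by exists 0, (k *: x); rewrite !mem0v add0r !memvZ ?memv_line.
by exists (k *: x), 0; rewrite !mem0v addr0 !memvZ ?memv_line.
Qed.

End Brackets.

(** * An Engel theorem relative to a nilpotent ideal *)

Section Engel.
Context {F : numClosedFieldType} {L : lieSuperalgebra F}.
Implicit Types (x y : L) (U V W A B I J : {vspace L}) (a b : bool).

Lemma br_swap a b c u x y :
  u \in ls_grade L a -> x \in ls_grade L b -> y \in ls_grade L c ->
  exists s : F,
    ls_br (ls_br u x) y = ls_br u (ls_br x y) + s *: ls_br (ls_br u y) x.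
Proof.
move=> Lu Lx Ly; rewrite (br_brC Lu Lx Ly).
rewrite (ls_skew Lx (ls_br_grade Lu Ly)) scalerN opprK scalerA.
by eexists.
Qed.

(** Membership in [W] is insensitive to the sign in [br_swap], so modulo [W] the actions of [x] and
    [y] may be exchanged. *)
Lemma br_swap_in U B W b x : graded_sub U -> graded_sub B ->
    x \in ls_grade L b ->
    (forall u y, u \in U -> y \in B -> ls_br u (ls_br x y) \in W) ->
    (forall u y, u \in U -> y \in B -> ls_br (ls_br u y) x \in W) ->
  forall u y, u \in U -> y \in B -> ls_br (ls_br u x) y \in W.
Proof.
move=> gU gB Lx W1 W2 u y.
case/(graded_split gU)=> u0 [u1 [U0 Lu0 U1 Lu1 ->]].
case/(graded_split gB)=> y0 [y1 [B0 Ly0 B1 Ly1 ->]].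
have key a c u' y' : u' \in U -> u' \in ls_grade L a -> y' \in B ->
    y' \in ls_grade L c -> ls_br (ls_br u' x) y' \in W.
  move=> Uu Lu By Ly; have [s ->] := br_swap Lu Lx Ly.
  by rewrite rpredD ?rpredZ ?W1 ?W2.
by rewrite !(brDl, brDr) !rpredD //; apply: key; eassumption.
Qed.

(** In the Engel argument [[x, x]] lies in [K], so this identity makes odd elements act with square
    zero. *)
Lemma odd_square u x : x \in ls_grade L true ->
  ls_br (ls_br u x) x = 2%:R^-1 *: ls_br u (ls_br x x).
Proof.
move=> Lx; have key a u' : u' \in ls_grade L a ->
    ls_br (ls_br u' x) x = 2%:R^-1 *: ls_br u' (ls_br x x).
  move=> Lu; rewrite (ls_jacobi Lu Lx Lx) (ls_skew Lx (ls_br_grade Lu Lx)).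
  rewrite scalerN scalerA; set v := ls_br (ls_br u' x) x.
  suff -> : (-1) ^+ (a && true) * (-1) ^+ (true && (a (+) true)) = -1 :> F.
    by rewrite scaleN1r opprK -mulr2n -scaler_nat scalerK // pnatr_eq0.
  by case: a {Lu}; rewrite /= ?expr1 ?expr0 ?mulr1 ?mul1r.
have [u0 [u1 [Lu0 Lu1 ->]]] := homogeneous_split u.
by rewrite !brDl (key _ _ Lu0) (key _ _ Lu1) scalerDr.
Qed.

Variables K A : {vspace L}.
Hypotheses (idK : ideal K) (nilK : nilpotent_sub K).
Hypotheses (idA : ideal A) (sKA : (K <= A)%VS) (AAK : (brv A A <= K)%VS).
Hypothesis nilA : forall x, x \in A -> x \in ls_grade L false ->
  exists k, forall v, v \in K -> iter k (ad x) v = 0.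

Let gK : graded_sub K. Proof. by case: idK. Qed.
Let gA : graded_sub A. Proof. by case: idA. Qed.

Section Step.
Variable W : {vspace L}.
Hypotheses (gW : graded_sub W) (WA : (brv W A <= W)%VS) (sWK : (W <= K)%VS).

(** [U / W] is a nonzero [A]-submodule of [K / W] on which [K] acts trivially; as [[A, A]] lies in
    [K], the elements of [A] commute up to sign on it. *)
Let good U := [/\ graded_sub U, (brv U A <= U)%VS, (brv U K <= W)%VS,
  (W <= U <= K)%VS & ~ (U <= W)%VS].

(** The last nonzero image of [U / W] under powers of [ad x] is annihilated by [x]. It stays
    annihilated by [B], which commutes with [x] up to sign there. *)
Let kill U B x b k : good U -> graded_sub B -> (brv U B <= W)%VS ->
    (B <= A)%VS -> x \in A -> x \in ls_grade L b ->
    (forall u, u \in U -> iter k (ad x) u \in W) ->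
  exists U', [/\ good U', (brv U' B <= W)%VS &
                 forall u, u \in U' -> ls_br u x \in W].
Proof.
move=> + gB + sBA Ax Lx; elim: k U => [|k IHk] U gU UB Uk.
  by case: gU => _ _ _ _ []; apply/subvP => u /Uk.
have [UW|nUW] := boolP (ad x @: U <= W)%VS.
  exists U; split=> // u Uu; rewrite -adE; apply: (subvP UW).
  exact: memv_img.
case: (gU) => grU UA UK /andP[sWU sUK] nW.
have Kxy y : y \in A -> ls_br x y \in K.
  by move=> Ay; apply/(subvP AAK)/memv_brv.
have swap Y Z : graded_sub Y -> (Y <= A)%VS -> (W <= Z)%VS ->
    (forall u y, u \in U -> y \in Y -> ls_br (ls_br u y) x \in Z) ->
    (brv (ad x @: U + W) Y <= Z)%VS.
  move=> gY sYA sWZ YZ; apply/brvP=> v y.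
  move=> /memv_addP[_ /memv_imgP[u Uu ->] [w Ww ->]] Yy.
  rewrite brDl adE; apply: rpredD.
    apply: (br_swap_in grU gY Lx _ YZ Uu Yy) => v' z Uv Yz.
    apply/(subvP sWZ)/(subvP UK)/memv_brv => //.
    by apply/Kxy/(subvP sYA).
  by apply/(subvP sWZ)/(subvP WA)/memv_brv => //; apply: (subvP sYA).
have Wx w : w \in W -> ls_br w x \in W.
  by move=> Ww; apply/(subvP WA)/memv_brv.
have [|||U' [gU' U'B U'x]] := IHk (ad x @: U + W)%VS.
- split.
  + by apply: graded_add => //; apply: graded_ad_img Lx.
  + apply: swap => // [|u y Uu Ay]; first exact: addvSr.
    rewrite -[ls_br _ x]addr0 memv_add ?mem0v // -adE memv_img //.
    by apply/(subvP UA)/memv_brv.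
  + apply: swap => // u y Uu Ky; apply/Wx/(subvP UK); exact: memv_brv.
  + rewrite addvSr subv_add sWK andbT; apply/subvP=> _ /memv_imgP[u Uu ->].
    by rewrite adE; apply/ideal_brr/(subvP sUK).
  + by rewrite subv_add subvv andbT; apply/negP.
- apply: swap => // u y Uu By; apply/Wx/(subvP UB); exact: memv_brv.
- move=> _ /memv_addP[_ /memv_imgP[u Uu ->] [w Ww ->]].
  have itD m v z : iter m (ad x) (v + z) = iter m (ad x) v + iter m (ad x) z.
    by elim: m => //= m ->; rewrite linearD.
  rewrite itD -iterSr rpredD ?Uk //.
  by elim: (k) => //= m; rewrite adE; apply: Wx.
by exists U'.
Qed.

(** One exponent serves every good [U]; for odd [x] it is 2, because [odd_square] lands in
    [[U, K]]. *)
Let nil_mod b x : x \in A -> x \in ls_grade L b ->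
  exists k, forall U, good U -> forall u, u \in U -> iter k (ad x) u \in W.
Proof.
case: b => [Ax Lx|Ax /(nilA Ax)[k xk]]; last first.
  exists k => U [_ _ _ /andP[_ /subvP sUK] _] u /sUK/xk->.
  exact: mem0v.
exists 2%N => U [_ _ UK _ _] u Uu; rewrite /= !adE odd_square // rpredZ //.
by apply/(subvP UK)/memv_brv => //; apply/(subvP AAK)/memv_brv.
Qed.

(** [B] is the part of [A] already acting trivially on [U / W] and [m] bounds its codimension in
    [A]; each round adjoins one homogeneous vector to [B]. *)
Let kill_all m U B : (\dim A <= \dim B + m)%N -> good U -> graded_sub B ->
  (B <= A)%VS -> (brv U B <= W)%VS -> exists U', good U' /\ (brv U' A <= W)%VS.
Proof.
elim: m U B => [|m IHm] U B leAB gU gB sBA UB.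
  suff eBA : B = A by exists U; split=> //; rewrite -eBA.
  by apply/eqP; rewrite eqEdim sBA; rewrite addn0 in leAB.
have [sAB|nAB] := boolP (A <= B)%VS.
  exists U; split=> //; apply: subv_trans UB; exact: brvS.
have [b [x [Ax Lx Bx]]] : exists b x,
    [/\ x \in A, x \in ls_grade L b & x \notin B].
  have [x Ax Bx] := subvPn nAB.
  have [x0 [x1 [A0 L0 A1 L1 ex]]] := graded_split gA Ax.
  have [B0|] := boolP (x0 \in B); last by exists false, x0.
  exists true, x1; split=> //; apply: contra Bx => B1.
  by rewrite ex rpredD.
have [k xk] := nil_mod Ax Lx.
have [U' [gU' U'B U'x]] := kill gU gB UB sBA Ax Lx (xk _ gU).
apply: (IHm U' (B + <[x]>)%VS) => //.
- have : (\dim B < \dim (B + <[x]>))%N.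
    rewrite ltn_neqAle dimvS ?addvSl // andbT; apply: contra Bx => /eqP eqd.
    have /eqP -> : B == (B + <[x]>)%VS by rewrite eqEdim addvSl eqd leqnn.
    by rewrite memvE addvSr.
  by lia.
- by apply: graded_add => //; apply: graded_line Lx.
- by rewrite subv_add sBA -memvE.
- apply/brvP=> u _ U'u /memv_addP[y By [_ /vlineP[c ->] ->]].
  rewrite brDr linearZ rpredD ?rpredZ ?U'x //.
  by apply/(subvP U'B)/memv_brv.
Qed.

(* Start from the last term of the lower central series of K not contained in *)
(* W: modulo W the elements of A then commute up to sign on it, so they can   *)
(* be made to act trivially one after the other.                              *)
Lemma engel_step : W <> K -> exists W',
  [/\ graded_sub W', (brv W' A <= W)%VS, (W <= W' <= K)%VS & ~~ (W' <= W)%VS].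
Proof.
move=> neWK; have lowK k : (lower_central K k <= K)%VS.
  elim: k => //= k; apply: subv_trans; case: (ideal_lower k idK) => _.
  by apply: subv_trans; apply: brvS; rewrite ?subvf.
have [k nk Sk] : exists2 k, ~ (lower_central K k <= W)%VS &
    (lower_central K k.+1 <= W)%VS.
  apply: contrapT => /forall2NP nex.
  have [k lk] := nilK.
  suff : ~ (lower_central K k <= W)%VS by rewrite lk sub0v.
  elim: k {lk} => [sKW|k IHk]; last by case: (nex k).
  by apply/neWK/eqP; rewrite eqEsubv sWK.
have [gk kL] := ideal_lower k idK; set Z := lower_central K k in nk Sk gk kL.
have gU : good (Z + W)%VS.
  split.
  - exact: graded_add.
  - apply/brvP=> _ y /memv_addP[z Zz [w Ww ->]] Ay.
    rewrite brDl memv_add //; last by apply/(subvP WA)/memv_brv.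
    by apply/(subvP kL)/memv_brv; rewrite ?memvf.
  - apply/brvP=> _ y /memv_addP[z Zz [w Ww ->]] Ky.
    rewrite brDl rpredD //; first by apply/(subvP Sk)/memv_brv.
    by apply/(subvP WA)/memv_brv => //; apply: (subvP sKA).
  - by rewrite addvSr subv_add lowK.
  - by move=> sW; apply: nk; apply: subv_trans sW; apply: addvSl.
have [||||U' [[grU' _ _ /andP[sWU' sU'K] nU'W] U'A]] :=
  @kill_all (\dim A) _ 0%VS _ gU.
- by rewrite leq_addl.
- by apply: graded_intro => x /[!memv0]/eqP->; exists 0, 0;
    rewrite !mem0v addr0.
- exact: sub0v.
- apply/brvP=> u v _ /[!memv0]/eqP->; by rewrite linear0 mem0v.
by exists U'; split; rewrite ?sWU' //; apply/negP.
Qed.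

End Step.

Lemma engel_nilpotent : nilpotent_sub A.
Proof.
have itA m W : graded_sub W -> (brv W A <= W)%VS -> (W <= K)%VS ->
    (\dim K <= \dim W + m)%N ->
    exists k, (iter k (fun U => brv U A) K <= W)%VS.
  elim: m W => [|m IHm] W gW WA sWK leKW.
    exists 0%N => /=; suff -> : W = K by [].
    by apply/eqP; rewrite eqEdim sWK; rewrite addn0 in leKW.
  have [->|/eqP neWK] := eqVneq W K; first by exists 0%N.
  have [W' [gW' W'A /andP[sWW' sW'K] nW'W]] := engel_step gW WA sWK neWK.
  have [||k kW'] := IHm W' gW' _ sW'K.
  - exact: subv_trans sWW'.
  - have : (\dim W < \dim W')%N.
      rewrite ltn_neqAle dimvS // andbT; apply: contra nW'W => /eqP eqd.
      by have /eqP -> : W == W' by rewrite eqEdim sWW' eqd leqnn.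
    by lia.
  by exists k.+1 => /=; apply: subv_trans W'A; apply: brvS.
have [||||k kA] := itA (\dim K) 0%VS; rewrite ?sub0v ?leq_addl //.
- by apply: graded_intro => x /[!memv0]/eqP->; exists 0, 0;
    rewrite !mem0v addr0.
- by apply/brvP=> u v; rewrite !memv0 => /eqP-> _; rewrite br0l.
(* The additional step is the first bracket, which takes [[A, A]] into [K]. *)
exists k.+1; apply/eqP; rewrite -subv0; apply: subv_trans kA.
by elim: k => //= k IHk; apply: brvS.
Qed.
End Engel.

(** * Derivations in an adapted basis *)

Section Derivations.
Context {F : numClosedFieldType} {N : lieSuperalgebra F}.
Implicit Types (d t u : 'End(N)) (T : {vspace 'End(N)}).

Lemma even_superder_lin a d u :
  even_superder d -> even_superder u -> even_superder (a *: d + u).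
Proof.
case=> dg dD [ug uD]; split=> [b|x y].
  apply/subvP=> _ /memv_imgP[x Nx ->]; rewrite !lfun_simp.
  rewrite rpredD ?rpredZ //; first exact/(subvP (dg b))/memv_img.
  exact/(subvP (ug b))/memv_img.
rewrite !lfun_simp dD uD brDl brDr brZl linearZ scalerDr /=.
by rewrite addrACA.
Qed.

Lemma even_superder0 : even_superder (0 : 'End(N)).
Proof.
split=> [b|x y]; last by rewrite !zero_lfunE br0l linear0 addr0.
by apply/subvP=> _ /memv_imgP[x Nx ->]; rewrite zero_lfunE mem0v.
Qed.

Lemma even_superder_grade d b x :
  even_superder d -> x \in ls_grade N b -> d x \in ls_grade N b.
Proof. by case=> dg _ Nx; apply/(subvP (dg b))/memv_img. Qed.

Lemma even_superder_commutator d u : even_superder d -> even_superder u ->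
  even_superder ((d \o u) - (u \o d))%VF.
Proof.
move=> dd ud; have [_ dD] := dd; have [_ uD] := ud; split=> [b|x y].
  apply/subvP=> _ /memv_imgP[x Nx ->]; rewrite !lfun_simp.
  by apply: rpredB; rewrite !even_superder_grade.
rewrite !lfun_simp uD dD !linearD /= !uD !dD !(brDl, brDr, brNl, linearN) /=.
apply: (coord_eq (vbasisP fullv)) => i; rewrite !(linearD, linearN) /=.
by ring.
Qed.

Lemma iterZ k c d x : iter k (c *: d) x = c ^+ k *: iter k d x.
Proof.
elim: k => [|k IHk]; first by rewrite scale1r.
by rewrite !iterS IHk scale_lfunE linearZ scalerA exprSr mulrC -exprSr.
Qed.

Lemma nonnilpotent_nil_independent d :
  even_superder d -> ~ nilpotent_end d -> nil_independent_der d.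
Proof.
move=> dd dn; exists 1%N, (fun=> d); split; last by exists ord0.
split=> // c [l]; rewrite (ord1 l) big_ord1 => c0 [k kn].
apply: dn; exists k => x; apply/eqP; have := kn x; rewrite iterZ => /eqP.
by rewrite scaler_eq0 expf_eq0 (negPf c0) andbF.
Qed.

End Derivations.

Section Adapted.
Context {F : numClosedFieldType} {N : lieSuperalgebra F}.
Variables (e : (\dim {:N}).-tuple N) (T : {vspace 'End(N)}).
Implicit Types (d t u : 'End(N)) (i j : 'I_(\dim {:N})).

Definition diagonal_in_basis d :=
  forall i j, i != j -> coord e j (d e`_i) = 0.

(* The i-th diagonal entry of a diagonal [t] is the value at [t] of the root  *)
(* of e_i, so the last two clauses say that t0 lies on no hyperplane          *)
(* [alpha = 0] nor [alpha = beta] with alpha <> beta roots.                   *)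
Definition adapted t0 : Prop :=
  [/\ basis_of fullv e,
      forall d, even_superder d -> below e 0 d /\ diagonal_part e d \in T,
      t0 \in T /\ forall t, t \in T -> diagonal_in_basis t,
      forall d i j, even_superder d -> i != j ->
        coord e i (t0 e`_i) = coord e j (t0 e`_j) -> coord e j (d e`_i) = 0 &
      forall i, coord e i (t0 e`_i) != 0].

End Adapted.

(** * Existence of an adapted basis and a generic element of the torus *)

Section AdaptedExists.
Context {F : numClosedFieldType} {N : lieSuperalgebra F}.
Variables (e : (\dim {:N}).-tuple N) (T : {vspace 'End(N)}).
Hypothesis eB : basis_of fullv e.
Implicit Types (d t u : 'End(N)) (i j : 'I_(\dim {:N})).

Lemma diagonal_part_coord d i j :
  coord e j (diagonal_part e d e`_i) = coord e i (d e`_i) *+ (i == j).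
Proof.
rewrite diagonal_partE (bigD1 i) //= big1 ?addr0 => [|l li].
  by rewrite linearZ /= !(basis_coord eB) eqxx mul1r mulr_natr.
by rewrite (basis_coord eB) eq_sym (negPf li) mul0r scale0r.
Qed.

Lemma diagonal_part_lin a d u :
  diagonal_part e (a *: d + u) = a *: diagonal_part e d + diagonal_part e u.
Proof.
apply: (lfun_basis_eq eB) => i j.
rewrite diagonal_part_coord !lfun_simp !linearD !linearZ /=.
by rewrite !diagonal_part_coord mulrnDl mulrnAr.
Qed.

Lemma diagonal_part_id d : diagonal_in_basis e d -> diagonal_part e d = d.
Proof.
move=> dd; apply: (lfun_basis_eq eB) => i j; rewrite diagonal_part_coord.
by have [<-|/dd->] := eqVneq i j.
Qed.

Lemma diagonal_part_diagonal d : diagonal_in_basis e (diagonal_part e d).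
Proof. by move=> i j /negPf ij; rewrite diagonal_part_coord ij. Qed.

(** Otherwise the coordinates of [(d + c u)^n x], with [n] the dimension, are polynomials in [c]
    vanishing at all positive integers, hence at 0, and [d] is nilpotent. *)
Lemma perturb_nonnilpotent d u : ~ nilpotent_end d ->
  exists k : nat, ~ nilpotent_end (d + k.+1%:R *: u).
Proof.
move=> dn; apply: contrapT => nex; apply: dn.
exists (\dim {:N}) => x.
have poly_iter k j : exists p : {poly F}, forall c,
    coord e j (iter k (d + c *: u) x) = p.[c].
  elim: k j => [|k IHk] j.
    by exists (coord e j x)%:P => c; rewrite hornerC.
  have /choice[p ep] := IHk.
  exists (\sum_i p i * ((coord e j (d e`_i))%:P + coord e j (u e`_i) *: 'X)).
  move=> c; rewrite iterS (coord_lfun eB) horner_sum; apply: eq_bigr => i _.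
  rewrite ep !lfun_simp linearD linearZ /= !hornerE; congr (_ * (_ + _)).
  by rewrite mulrC.
apply: (coord_eq eB) => j; rewrite linear0.
have [p ep] := poly_iter (\dim {:N}) j.
have p0 : p = 0.
  apply: poly0_nat => k; rewrite -ep.
  have kn := contrapT (fun nk => nex (ex_intro _ k nk)).
  by rewrite nilpotent_iter_dim // linear0.
by have := ep 0; rewrite scale0r addr0 p0 horner0.
Qed.

Lemma nilpotent_diagonal0 d : below e 0 d -> nilpotent_end d ->
  diagonal_part e d = 0.
Proof.
move=> d0 [k dk]; apply: (lfun_basis_eq eB) => i j.
rewrite diagonal_part_coord zero_lfunE linear0.
have /eqP := coord_iter_diag eB k i d0.
by rewrite dk linear0 eq_sym expf_eq0 => /andP[_ /eqP->]; rewrite mul0rn.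
Qed.

Lemma below1P d : below e 0 d -> diagonal_part e d = 0 -> below e 1 d.
Proof.
move=> d0 dd i j; rewrite addn1 ltnS leq_eqVlt => /predU1P[/val_inj ij|ij].
  have := congr1 (fun u : 'End(N) => coord e j (u e`_i)) dd.
  by rewrite diagonal_part_coord zero_lfunE linear0 ij eqxx mulr1n.
by apply: d0; rewrite addn0.
Qed.

End AdaptedExists.

Lemma adapted_exists (F : numClosedFieldType) (N : lieSuperalgebra F) :
  ~ characteristically_nilpotent N -> d_locally_diagonalizable N ->
  exists (e : (\dim {:N}).-tuple N) (T : {vspace 'End(N)}) t0,
    maximal_torus T /\ adapted e T t0.
Proof.
move=> /existsNP[d0 /not_implyP[d0d d0n]].
case=> e [T [[eB up] [maxT [diagT genT]] rootd root0]]; exists e, T.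
(* Non-nilpotent even superderivations span all of them: [d] is a multiple of the difference of [d0]
   and a non-nilpotent perturbation [d0 + (k+1) d]. Linear properties of nil-independent derivations
   thus extend to every even superderivation. *)
have span (P : 'End(N) -> Prop) :
    (forall a d u, P d -> P u -> P (a *: d + u)) ->
    (forall d, nil_independent_der d -> P d) ->
    forall d, even_superder d -> P d.
  move=> Plin Pnil d dd.
  have [k] := perturb_nonnilpotent eB d d0n.
  set d1 := d0 + _ => d1n.
  have d1d : even_superder d1 by rewrite /d1 addrC; apply: even_superder_lin.
  have P0 := Pnil _ (nonnilpotent_nil_independent d0d d0n).
  have P1 := Pnil _ (nonnilpotent_nil_independent d1d d1n).
  have Pz : P 0 by rewrite -(addNr d0) -scaleN1r; apply: Plin.
  have -> : d = k.+1%:R^-1 *: (-1 *: d0 + d1) + 0.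
    by rewrite /d1 scaleN1r addKr scalerK ?pnatr_eq0 // addr0.
  exact: (Plin _ _ _ (Plin _ _ _ P0 P1) Pz).
have Tdiag t : t \in T -> diagonal_in_basis e t.
  have [||U UP] := @vspace_of_pred _ _ (diagonal_in_basis e).
  - by move=> i j _; rewrite zero_lfunE linear0.
  - move=> a u v du dv i j ij.
    by rewrite !lfun_simp linearD linearZ /= du ?dv // mulr0 addr0.
  have /subvP sTU : (T <= U)%VS.
    by apply: genT => d _; apply/UP; apply: diagonal_part_diagonal.
  by move=> /sTU/UP.
have derT d : even_superder d -> below e 0 d /\ diagonal_part e d \in T.
  apply: (span (fun d => below e 0 d /\ diagonal_part e d \in T)) => {d}
    [a d u [d0' dT] [u0 uT]|d dn].
    by split; [exact: below_lin | rewrite diagonal_part_lin // rpredD ?rpredZ].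
  by split; [move=> i j; rewrite addn0; apply: up | exact: diagT].
pose al i : 'Hom(subvs_of T, F^o) :=
  linfun (fun t : subvs_of T => coord e i (vsval t e`_i) : F^o).
have alE i t : al i t = coord e i (vsval t e`_i).
  pose f (t : subvs_of T) := coord e i (vsval t e`_i) : F^o.
  have lf : linear f.
    by move=> a u v; rewrite /f linearP !lfun_simp linearD linearZ.
  exact: (linfunE lf).
have alP i : in_root_space (al i) e`_i.
  move=> t; rewrite alE; apply: (coord_eq eB) => j; rewrite linearZ /=.
  rewrite (basis_coord eB); have [<-|ij] := eqVneq i j; first by rewrite mulr1.
  by rewrite Tdiag ?subvsP // mulr0.
have e0 (i : 'I_(\dim {:N})) : e`_i != 0.
  apply/eqP => ei; have := basis_coord eB i i.
  by rewrite ei linear0 eqxx => /eqP; rewrite eq_sym oner_eq0.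
have al_root i : Defs.root (al i) by exists e`_i.
have al0 i : exists2 t, t \in T & coord e i (t e`_i) != 0.
  apply: contrapT => nt; apply: root0; have <- : al i = 0; last exact: al_root.
  apply/lfunP=> t; rewrite alE zero_lfunE; apply/eqP; apply: contrapT => tn.
  by apply: nt; exists (vsval t); [exact: subvsP | apply/negP].
(* A nonzero coordinate of a root vector fixes its root, so the [al i] exhaust the roots. *)
have in_al i (be : 'Hom(subvs_of T, F^o)) x :
    in_root_space be x -> coord e i x != 0 -> be = al i.
  move=> bx xi; apply/lfunP=> t; rewrite alE; apply: (mulIf xi).
  have := congr1 (coord e i) (bx t); rewrite linearZ /= => <-.
  rewrite (coord_lfun eB) (bigD1 i) //= big1 ?addr0 1?mulrC // => l li.
  by rewrite Tdiag ?subvsP // mulr0.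
have same i j d : even_superder d -> i != j -> al i = al j ->
    coord e j (d e`_i) = 0.
  move=> + ij eal; apply: (span (fun d => coord e j (d e`_i) = 0)) => {d}
    [a d u di ui|d dn].
    by rewrite !lfun_simp linearD linearZ /= di ui mulr0 addr0.
  (* The projection onto the root subspace of [al i]: it keeps the basis vectors carrying that
     root. *)
  pose f (x : N) := \sum_(l | al l == al i) coord e l x *: e`_l.
  have lf : linear f.
    move=> a u v; rewrite /f scaler_sumr -big_split; apply: eq_bigr => l _ /=.
    by rewrite linearD linearZ scalerDl scalerA.
  pose p := linfun f.
  have pE x : p x = f x by exact: (linfunE lf).
  have pP : root_projection (al i) p.
    split=> [x xi|be x bi xb]; rewrite pE /f.
      rewrite {2}(basis_expand eB x) big_mkcond; apply: eq_bigr => l _.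
      case: eqP => // ali; have [->|xl] := eqVneq (coord e l x) 0.
        by rewrite scale0r.
      by case: ali; rewrite (in_al _ _ _ xi xl).
    rewrite big1 // => l /eqP ali; have [->|xl] := eqVneq (coord e l x) 0.
      by rewrite scale0r.
    by move: bi; rewrite (in_al _ _ _ xb xl) ali eqxx.
  have [c] := rootd _ _ _ (al_root i) pP dn i (alP i).
  move/(congr1 (coord e j)); rewrite linearZ /= (basis_coord eB) (negPf ij).
  rewrite mulr0 pE /f linear_sum (bigD1 j) ?eal //= big1 ?addr0.
    by rewrite linearZ /= (basis_coord eB) eqxx mulr1.
  by move=> l /andP[_ lj]; rewrite linearZ /= (basis_coord eB) (negPf lj) mulr0.
pose n := \dim {:N}.
(* The functionals to avoid: the roots of the [e_i] and their pairwise differences. *)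
pose g (s : 'I_n + 'I_n * 'I_n) (t : 'End(N)) : F := match s with
  | inl i => coord e i (t e`_i)
  | inr (i, j) => coord e i (t e`_i) - coord e j (t e`_j) end.
have [|t0 Tt0 gt0] := @generic_vector _ _ T _ g.
  case=> [i|[i j]] a u v /=; rewrite !lfun_simp !linearD !linearZ //=.
  by rewrite mulrBr opprD addrACA.
exists t0; split=> //; split=> // [d i j dd ij eij|i]; last first.
  exact: (gt0 (inl i) (al0 i)).
apply: same => //; apply/lfunP=> t; rewrite !alE; apply/eqP.
rewrite -subr_eq0; apply: contrapT => /negP nt; suff: false by [].
have := gt0 (inr (i, j)); rewrite /= eij subrr eqxx; apply.
by exists (vsval t); first exact: subvsP.
Qed.

(** * Conjugation by unipotent automorphisms *)

(** The part of the square outside the triangle has [i + j >= 2n], so one index is at least [n].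
    This is the Cauchy product of two series of length [n]. *)
Lemma triangular_sum (G : zmodType) (n : nat) (f : nat -> nat -> G) :
    (forall i j, (n <= i)%N || (n <= j)%N -> f i j = 0) ->
  \sum_(k < n + n) \sum_(i < k.+1) f i (k - i)%N =
    \sum_(i < n + n) \sum_(j < n + n) f i j.
Proof.
move=> f0; set m := (n + n)%N.
transitivity (\sum_(k < m) \sum_(i < m | (i < k.+1)%N) f i (k - i)%N).
  by apply: eq_bigr => k _; rewrite (big_ord_widen m (fun i => f i (k - i)%N)).
rewrite (exchange_big_dep xpredT) //=; apply: eq_bigr => i _.
rewrite -(big_geq_mkord i m xpredT (fun k => f i (k - i)%N)).
rewrite -{1}[nat_of_ord i]add0n big_addn.
under eq_bigr do rewrite addnK.
rewrite -(big_mkord xpredT (f i)).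
rewrite [RHS](big_cat_nat (n := (m - i)%N)) ?leq_subr //=.
rewrite [X in _ + X]big_nat_cond [X in _ + X]big1 ?addr0 // => j.
rewrite andbT => /andP[lj _]; apply: f0; case: (leqP n i) => //= ni.
have lmi : (n <= n + n - i)%N by rewrite -(addnBA n (ltnW ni)) leq_addr.
exact: leq_trans lmi lj.
Qed.

Section Automorphisms.
Context {F : numClosedFieldType} {N : lieSuperalgebra F}.
Implicit Types (d t u g h : 'End(N)).

(** In finite dimension injectivity gives bijectivity. *)
Definition automorphism g := ls_hom g /\ lker g == 0%VS.

Lemma automorphism1 : automorphism \1%VF.
Proof.
split; last by apply/lker0P=> x y; rewrite !id_lfunE.
by split=> [b|x y]; rewrite ?lim1g // !id_lfunE.
Qed.

Lemma automorphism_comp g h :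
  automorphism g -> automorphism h -> automorphism (g \o h)%VF.
Proof.
case=> -[gg gD] /lker0P gi [[hg hD] /lker0P hi]; split.
  split=> [b|x y]; last by rewrite !comp_lfunE hD gD.
  by rewrite limg_comp; apply: subv_trans (gg b); apply: limgS.
by apply/lker0P=> x y; rewrite !comp_lfunE => /gi/hi.
Qed.

Lemma automorphism_grade g b x : automorphism g ->
  x \in ls_grade N b -> g x \in ls_grade N b.
Proof. by case=> -[gg _] _ Lx; apply/(subvP (gg b))/memv_img. Qed.

Lemma automorphism_inv_grade g b x : automorphism g ->
  x \in ls_grade N b -> (g^-1)%VF x \in ls_grade N b.
Proof.
case=> -[gg _] g0 Lx.
have eg : (g @: ls_grade N b = ls_grade N b)%VS.
  by apply/eqP; rewrite eqEdim gg limg_dim_eq ?leqnn // (eqP g0) capv0.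
by move: Lx; rewrite -{1}eg => /memv_imgP[y Ly ->]; rewrite lker0_lfunK.
Qed.

Lemma automorphism_conj g d : automorphism g -> even_superder d ->
  even_superder (g \o d \o g^-1)%VF.
Proof.
move=> gA [dg dD]; have [[gg gD] g0] := gA; split=> [b|x y].
  apply/subvP=> _ /memv_imgP[x Lx ->]; rewrite !comp_lfunE.
  apply/(automorphism_grade gA)/(subvP (dg b))/memv_img.
  exact: automorphism_inv_grade.
rewrite !comp_lfunE -{1}(lker0_lfunVK g0 x) -{1}(lker0_lfunVK g0 y).
by rewrite -gD lker0_lfunK // dD linearD /= !gD !lker0_lfunVK.
Qed.

(** The truncated exponential series, exact once [u^m = 0]. *)
Definition lexp m u : 'End(N) :=
  \sum_(k < m) k`!%:R^-1 *: iter k (comp_lfun u) \1%VF.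

Lemma iter_compE k u x : iter k (comp_lfun u) \1%VF x = iter k u x.
Proof. by elim: k => [|k IHk]; rewrite ?id_lfunE //= comp_lfunE IHk. Qed.

Lemma lexpE m u x : lexp m u x = \sum_(k < m) k`!%:R^-1 *: iter k u x.
Proof.
by rewrite sum_lfunE; apply: eq_bigr => k _; rewrite scale_lfunE iter_compE.
Qed.

(** Leibniz's rule for the divided powers [u^k / k!], where no binomials occur: in the inductive
    step the coefficients [i] and [k + 1 - i] add up to [k + 1]. *)
Lemma iter_der_divided u k x y : even_superder u ->
  k`!%:R^-1 *: iter k u (ls_br x y) =
    \sum_(i < k.+1)
       ls_br (i`!%:R^-1 *: iter i u x) ((k - i)`!%:R^-1 *: iter (k - i) u y).
Proof.
case=> _ uD; pose p i z : N := i`!%:R^-1 *: iter i u z.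
have pS i z : u (p i z) = i.+1%:R *: p i.+1 z.
  rewrite /p linearZ scalerA factS natrM invfM mulrA mulfV ?mul1r //.
  by rewrite pnatr_eq0.
rewrite -/(p k _); elim: k => [|k IHk].
  by rewrite big_ord1 /p fact0 invr1 !scale1r.
have k0 : k.+1%:R != 0 :> F by rewrite pnatr_eq0.
apply: (scalerI k0); rewrite -pS IHk linear_sum /=.
under eq_bigr do rewrite uD !pS.
rewrite big_split /=; pose q i := ls_br (p i x) (p (k.+1 - i)%N y).
have -> : \sum_(i < k.+1) ls_br (i.+1%:R *: p i.+1 x) (p (k - i)%N y) =
    \sum_(i < k.+2) i%:R *: q i.
  rewrite [RHS]big_ord_recl scale0r add0r; apply: eq_bigr => i _.
  by rewrite brZl /q subSS.
have -> : \sum_(i < k.+1) ls_br (p i x) ((k - i).+1%:R *: p (k - i).+1 y) =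
    \sum_(i < k.+2) (k.+1 - i)%:R *: q i.
  rewrite [RHS]big_ord_recr /= subnn scale0r addr0; apply: eq_bigr => i _.
  by rewrite linearZ /q subSn // -ltnS.
rewrite -big_split scaler_sumr; apply: eq_bigr => i _ /=.
by rewrite -scalerDl -natrD subnKC // -ltnS.
Qed.

Lemma lexp_hom n u : even_superder u -> (forall x, iter n u x = 0) ->
  ls_hom (lexp (n + n) u).
Proof.
move=> ud un; split=> [b|x y].
  apply/subvP=> _ /memv_imgP[x Lx ->]; rewrite lexpE rpred_sum // => k _.
  apply: rpredZ; elim: (nat_of_ord k) => //= m; exact: even_superder_grade.
rewrite !lexpE; under eq_bigr do rewrite iter_der_divided //.
pose f i j := ls_br (i`!%:R^-1 *: iter i u x) (j`!%:R^-1 *: iter j u y).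
have iter0 i z : (n <= i)%N -> iter i u z = 0.
  by move=> ni; rewrite -(subnKC ni) iterD un.
rewrite (triangular_sum (n := n) (f := f)) => [|i j /orP[ni|nj]]; last first.
- by rewrite /f (iter0 j) // scaler0 linear0.
- by rewrite /f (iter0 i) // scaler0 br0l.
rewrite -[RHS]adE [RHS]linear_sum; apply: eq_bigr => i _.
by rewrite [RHS]adE [RHS]linear_sum.
Qed.

End Automorphisms.

Section Conjugation.
Context {F : numClosedFieldType} {N : lieSuperalgebra F}.
Variables (e : (\dim {:N}).-tuple N) (T : {vspace 'End(N)}) (t0 : 'End(N)).
Hypotheses (torT : torus T) (adT : adapted e T t0).
Implicit Types (d t u g : 'End(N)).

Let eB : basis_of fullv e. Proof. by case: adT. Qed.
Let Tt0 : t0 \in T. Proof. by case: adT => _ _ []. Qed.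

Lemma torus_der t : t \in T -> even_superder t.
Proof. by case: torT => td _ _ /td. Qed.

Lemma torus_diagonal t : t \in T -> diagonal_in_basis e t.
Proof. by case: adT => _ _ [_ Td] _ _ /Td. Qed.

Lemma der_below0 d : even_superder d -> below e 0 d.
Proof. by case: adT => _ + _ _ _ => /[apply]-[]. Qed.

(** Commuting with [t0] kills the entries between different eigenvalues of [t0], and adaptedness
    kills the off-diagonal entries between equal ones. So [d] is its own diagonal part. *)
Lemma commuting_in_torus d :
  even_superder d -> (d \o t0 = t0 \o d)%VF -> d \in T.
Proof.
move=> dd dt0; rewrite -(diagonal_part_id eB (d := d)).
  by case: adT => _ /(_ d dd)[].
have [_ _ _ same _] := adT; move=> i j ij.
have [/(same _ _ _ dd ij)//|ne] :=
  eqVneq (coord e i (t0 e`_i)) (coord e j (t0 e`_j)).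
have ti l x : coord e l (t0 x) = coord e l x * coord e l (t0 e`_l).
  rewrite (coord_lfun eB) (bigD1 l) //= big1 ?addr0 // => m ml.
  by rewrite torus_diagonal ?mulr0.
have te (l : 'I_(\dim {:N})) : t0 e`_l = coord e l (t0 e`_l) *: e`_l.
  apply: (coord_eq eB) => m; rewrite linearZ /= (basis_coord eB).
  by have [<-|lm] := eqVneq l m; rewrite ?mulr1 // torus_diagonal ?mulr0.
have := congr1 (fun f : 'End(N) => coord e j (f e`_i)) dt0.
rewrite !comp_lfunE ti te !linearZ /= mulrC => /eqP.
rewrite -subr_eq0 -mulrBr mulf_eq0 => /orP[/eqP//|].
by rewrite subr_eq0 (negPf ne).
Qed.

(* [ad t0] preserves the space of derivations in [below k.+1] and, as t0 has *)
(* centralizer T, is injective on it.                                         *)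
Lemma ad_t0_surj k d : even_superder d -> below e k.+1 d ->
  exists u, [/\ even_superder u, below e k.+1 u &
                ((t0 \o u) - (u \o t0))%VF = d].
Proof.
move=> dd dk.
have [||V VP] := @vspace_of_pred _ _
  (fun u => even_superder u /\ below e k.+1 u).
- by split; [exact: even_superder0 | exact: below0].
- move=> a u v [ud uk] [vd vk].
  by split; [exact: even_superder_lin | exact: below_lin].
pose f u := ((t0 \o u) - (u \o t0))%VF.
have lf : linear f.
  move=> a u v; rewrite /f comp_lfunDr comp_lfunDl -comp_lfunZr -comp_lfunZl.
  by rewrite scalerBr opprD addrACA.
pose fl := linfun f.
have flE u : fl u = f u by exact: (linfunE lf).
have f0 : (V :&: lker fl)%VS = 0%VS.
  apply/eqP; rewrite -subv0; apply/subvP=> u.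
  rewrite memv_cap memv_ker flE memv0 => /andP[/VP[ud uk] /eqP/eqP].
  rewrite /f subr_eq0 => /eqP ut.
  have /torus_diagonal uu := commuting_in_torus ud (esym ut).
  apply/eqP/(lfun_basis_eq eB) => i j; rewrite zero_lfunE linear0.
  have [<-|/uu//] := eqVneq i j; apply: uk; lia.
have sfV : (fl @: V <= V)%VS.
  apply/subvP=> _ /memv_imgP[u /VP[ud uk] ->]; rewrite flE.
  have td := torus_der Tt0; have t0b := der_below0 td.
  apply/VP; split; first exact: even_superder_commutator.
  apply: belowB; first by rewrite -[k.+1]add0n; apply: (below_comp eB).
  by rewrite -[k.+1]addn0; apply: (below_comp eB).
have fV : (fl @: V = V)%VS.
  by apply/eqP; rewrite eqEdim sfV limg_dim_eq ?leqnn.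
have : d \in V by apply/VP.
rewrite -fV => /memv_imgP[u /VP[ud uk] ->]; exists u.
by rewrite flE.
Qed.

Lemma lexp_expand m k u : below e k.+1 u ->
  exists2 r, below e k.+2 r & lexp m.+2 u = (\1 + u + r)%VF.
Proof.
move=> uk.
exists (\sum_(i < m) i.+2`!%:R^-1 *: iter i.+2 (comp_lfun u) \1%VF).
  apply: big_ind => [|f g|i _]; [exact: below0 | exact: belowD |].
  apply: belowZ; elim: (nat_of_ord i) => [|l IHl] /=.
    rewrite comp_lfun1r; apply: (belowW (k := (k.+1 + k.+1)%N)); first by lia.
    exact: (below_comp eB).
  apply: (belowW (k := (k.+1 + k.+2)%N)); first by lia.
  exact: (below_comp eB).
rewrite /lexp !big_ord_recl /= comp_lfun1r !fact0 invr1 !scale1r addrA.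
by congr (_ + _); apply: eq_bigr.
Qed.

Lemma unipotent_inj k v : below e k.+1 v -> lker (\1 + v)%VF == 0%VS.
Proof.
move=> vk; apply: (below0_inj eB) => [i j|i].
  rewrite addn0 => ij; rewrite !lfun_simp linearD /= (basis_coord eB).
  rewrite vk; last by lia.
  by rewrite addr0 -val_eqE ltn_eqF.
rewrite !lfun_simp linearD /= (basis_coord eB) eqxx vk ?addr0 ?oner_neq0 //.
by lia.
Qed.

(* Take [u] with [t0, u] = d - t0 and conjugate by exp u.                     *)
Lemma conj_step k d : even_superder d -> below e k.+1 (d - t0) ->
  exists2 g, automorphism g & below e k.+2 ((g \o d \o g^-1)%VF - t0).
Proof.
move=> dd dk; have td := torus_der Tt0.
have nd : even_superder (d - t0).
  by rewrite addrC -scaleN1r; apply: even_superder_lin.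
have [u [ud uk ut]] := ad_t0_surj nd dk.
(* The successor makes the truncation order visibly at least 2, as [lexp_expand] requires. *)
set n := (\dim {:N}).+1; pose g := lexp (n + n) u.
have un x : iter n u x = 0.
  rewrite /n iterS (below1_nilpotent eB) ?linear0 //.
  by apply: belowW uk.
have gh : ls_hom g by apply: lexp_hom.
have [r rk eg] : exists2 r, below e k.+2 r & g = (\1 + u + r)%VF.
  by rewrite /g /n addSn addnS; apply: lexp_expand.
have vk : below e k.+1 (u + r).
  by apply: belowD => //; apply: belowW rk.
have g0 : lker g == 0%VS by rewrite eg -addrA; apply: unipotent_inj vk.
have gA : automorphism g by [].
exists g => //; set m := (_ - t0).
have cd := automorphism_conj gA dd.
have m0 : below e 0 m.
  by apply: belowB; apply: der_below0.
(* In [g d - t0 g] the relation [[t0, u] = d - t0] cancels the lowest-order term; each remaining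
   product has level at least [k + 2]. *)
have mg : below e k.+2 (m \o g)%VF.
  have -> : (m \o g)%VF =
      ((u \o (d - t0)) + (r \o d) - (t0 \o r))%VF.
    apply/lfunP=> x; have utx := congr1 (fun f : 'End(N) => f x) ut.
    have gE y : g y = y + u y + r y by rewrite eg !lfun_simp.
    rewrite /m !(comp_lfunE, add_lfunE, opp_lfunE) lker0_lfunK //.
    rewrite !gE; move: utx; rewrite !lfun_simp /= !linearD !linearN /=.
    move/eqP; rewrite subr_eq => /eqP->.
    apply: (coord_eq eB) => j; rewrite !(linearD, linearN) /=.
    by ring.
  apply: belowB; last by rewrite -[k.+2]add0n; apply: (below_comp eB) => //;
    exact: der_below0.
  apply: belowD; last by rewrite -[k.+2]addn0; apply: (below_comp eB) => //;
    exact: der_below0.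
  apply: (belowW (k := (k.+1 + k.+1)%N)); first by lia.
  exact: (below_comp eB).
have em : m = (m \o g)%VF - (m \o (u + r))%VF.
  clearbody m; apply/lfunP=> x.
  rewrite eg -addrA !(comp_lfunE, add_lfunE, opp_lfunE) id_lfunE.
  by rewrite linearD addrK.
(* The identity [m = m g - m (u + r)] raises the level of [m] step by step, without any estimate on
   the inverse of [g]. *)
suff ml l : (l <= k.+2)%N -> below e l m by apply: ml.
elim: l => [//|l IHl] ll; rewrite em; apply: belowB.
  exact: belowW mg.
apply: (belowW (k := (l + k.+1)%N)); first by lia.
by apply: (below_comp eB) => //; apply: IHl; lia.
Qed.

(** Each [conj_step] raises the level of the difference from [t0] by one, and at level [\dim {:N}]
    the difference is zero. *)
Lemma conj_to_torus d : even_superder d -> diagonal_part e d = t0 ->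
  exists2 g, automorphism g & (g \o d = t0 \o g)%VF.
Proof.
move=> dd dt.
have d1 : below e 1 (d - t0).
  apply: (below1P eB).
    by apply: belowB; apply: der_below0 => //; apply: torus_der.
  rewrite addrC -scaleN1r (diagonal_part_lin eB) dt.
  by rewrite (diagonal_part_id eB (torus_diagonal Tt0)) scaleN1r addNr.
suff H m k d' : even_superder d' -> below e k.+1 (d' - t0) ->
    (\dim {:N} <= k + m)%N ->
    exists2 g, automorphism g & (g \o d' = t0 \o g)%VF.
  by apply: (H (\dim {:N}) 0%N) => //; rewrite add0n.
elim: m k d' => [|m IHm] k d' dd' dk leN.
  exists \1%VF; first exact: automorphism1.
  rewrite comp_lfun1l comp_lfun1r; apply/eqP; rewrite -subr_eq0.
  by rewrite (below_ge eB _ dk) // ; lia.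
have [g gA gk] := conj_step dd' dk.
have [|h hA hd] := IHm k.+1 _ (automorphism_conj gA dd') gk; first by lia.
exists (h \o g)%VF; first exact: automorphism_comp.
rewrite comp_lfunA -hd -!comp_lfunA; congr (_ \o (_ \o _))%VF.
by rewrite lker0_compVf ?comp_lfun1r //; case: gA.
Qed.

End Conjugation.

(** * The structure of extensions *)

Section Extension.
Context {F : numClosedFieldType} {N : lieSuperalgebra F}.
Variables (L : lieSuperalgebra F) (iota : 'Hom(N, L)).
Hypotheses (iota_hom : ls_hom iota) (iota_inj : lker iota = 0%VS).
Hypothesis idK : ideal (limg iota).
Implicit Types (x y : L) (m n : N).

Local Notation K := (limg iota).
Local Notation L0 := (ls_grade L false).
Local Notation L1 := (ls_grade L true).

Let iotaK : cancel iota (iota^-1)%VF.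
Proof. by apply: lker0_lfunK; rewrite iota_inj. Qed.

Lemma iota_grade b n : n \in ls_grade N b -> iota n \in ls_grade L b.
Proof. by case: iota_hom => ig _ Ln; apply/(subvP (ig b))/memv_img. Qed.

Lemma iota_grade_inv b n : iota n \in ls_grade L b -> n \in ls_grade N b.
Proof.
have [n0 [n1 [Ln0 Ln1 ->]]] := homogeneous_split n; rewrite linearD /=.
have In0 := iota_grade Ln0; have In1 := iota_grade Ln1.
have z n' : iota n' = 0 -> n' = 0.
  by move=> e0; apply: (can_inj iotaK); rewrite e0 linear0.
case: b => [I1|I0].
  have /z-> : iota n0 = 0; last by rewrite add0r.
  by apply: grade_disjoint; rewrite // -(addrK (iota n1) (iota n0)) rpredB.
have /z-> : iota n1 = 0; last by rewrite addr0.
apply: grade_disjoint => //.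
by rewrite -(addKr (iota n0) (iota n1)) rpredD ?rpredN.
Qed.

Definition adN x : 'End(N) := linfun (fun n => (iota^-1)%VF (ls_br (iota n) x)).

Lemma adNE x n : iota (adN x n) = ls_br (iota n) x.
Proof.
rewrite linfunE => [|a u v]; last by rewrite linearP /= ls_br_linl linearP.
by rewrite limg_lfunVK // ideal_brr // memv_img ?memvf.
Qed.

Lemma adN_lin a x y : adN (a *: x + y) = a *: adN x + adN y.
Proof.
apply/lfunP=> n; apply: (can_inj iotaK).
by rewrite add_lfunE scale_lfunE linearD linearZ /= !adNE linearD linearZ.
Qed.

Lemma adN_der x : x \in L0 -> even_superder (adN x).
Proof.
move=> Lx; have [_ iD] := iota_hom; split=> [b|n m].
  apply/subvP=> _ /memv_imgP[n Ln ->]; apply: iota_grade_inv.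
  rewrite adNE -[b]addbF; apply: ls_br_grade => //; exact: iota_grade.
apply: (can_inj iotaK).
by rewrite adNE iD ad_even_der // linearD /= !iD !adNE.
Qed.

(** The commutator comes out reversed because of the right-handed convention. *)
Lemma adN_br x y : x \in L0 -> y \in L0 ->
  adN (ls_br x y) = ((adN y \o adN x) - (adN x \o adN y))%VF.
Proof.
move=> Lx Ly; apply/lfunP=> n; apply: (can_inj iotaK).
rewrite add_lfunE opp_lfunE !comp_lfunE linearB /= !adNE.
by rewrite (ad_even_der _ _ Ly) addrAC subrr add0r.
Qed.

Lemma iter_adN k x n : iota (iter k (adN x) n) = iter k (ad x) (iota n).
Proof. by elim: k => //= k IHk; rewrite adNE IHk adE. Qed.

(** The first bracket with [x] enters [J], and each further one descends its lower central
    series. *)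
Lemma nilpotent_adN x J : nilpotent_sub J -> ideal J -> x \in J ->
  nilpotent_end (adN x).
Proof.
move=> [k Jk] idJ Jx; exists k.+1 => n; apply: (can_inj iotaK).
rewrite iter_adN linear0 iterSr adE; apply/eqP; rewrite -memv0 -Jk.
elim: k {Jk} => [|k IHk] /=; first exact: ideal_brl.
by rewrite adE; apply: memv_brv.
Qed.

Variables (e : (\dim {:N}).-tuple N) (T : {vspace 'End(N)}) (t0 : 'End(N)).
Hypotheses (torT : torus T) (adT : adapted e T t0).

Let eB : basis_of fullv e. Proof. by case: adT. Qed.

Definition diag_adN : 'Hom(L, 'End(N)) :=
  linfun (fun x => diagonal_part e (adN x)).

Lemma diag_adNE x : diag_adN x = diagonal_part e (adN x).
Proof.
apply: (linfunE (f := fun x => diagonal_part e (adN x))) => a u v.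
by rewrite adN_lin (diagonal_part_lin eB).
Qed.

Lemma diag_commutator0 (d u : 'End(N)) : below e 0 d -> below e 0 u ->
  diagonal_part e ((d \o u) - (u \o d))%VF = 0.
Proof.
move=> d0 u0; have diag_comp (f g : 'End(N)) i : below e 0 f -> below e 0 g ->
    coord e i (f (g e`_i)) = coord e i (g e`_i) * coord e i (f e`_i).
  move=> f0 g0; rewrite (coord_lfun eB) (bigD1 i) //= big1 ?addr0 // => l.
  rewrite -val_eqE neq_ltn => /orP[li|il].
    by rewrite f0 ?mulr0 // addn0.
  by rewrite g0 ?mul0r // addn0.
apply: (lfun_basis_eq eB) => i j; rewrite (diagonal_part_coord eB).
have [<-|_] := eqVneq i j; last by rewrite mulr0n zero_lfunE linear0.
rewrite add_lfunE opp_lfunE !comp_lfunE linearB /= !diag_comp // mulrC subrr.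
by rewrite mul0rn zero_lfunE linear0.
Qed.

Lemma diag_adN_br x y : x \in L0 -> y \in L0 -> diag_adN (ls_br x y) = 0.
Proof.
move=> Lx Ly; rewrite diag_adNE adN_br // diag_commutator0 //;
  by apply: (der_below0 adT); apply: adN_der.
Qed.

Lemma diag_adN_torus x : x \in L0 -> diag_adN x \in T.
Proof.
by move=> Lx; rewrite diag_adNE; case: adT => _ /(_ _ (adN_der Lx))[].
Qed.

Lemma nilpotent_diag_adN x J : nilpotent_sub J -> ideal J -> x \in J ->
  x \in L0 -> diag_adN x = 0.
Proof.
move=> nJ idJ Jx Lx; rewrite diag_adNE (nilpotent_diagonal0 eB) //.
  exact/(der_below0 adT)/adN_der.
exact: nilpotent_adN Jx.
Qed.

Section Solvable.
Hypotheses (nilK : nilpotent_sub K)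
  (maxK : forall J, ideal J -> nilpotent_sub J -> (J <= K)%VS)
  (solL : solvable_ls L) (lieL : lie_theorem_condition L).

Let H := (L0 :&: lker diag_adN)%VS.
(** In the end [I] equals the nilradical, by [sKI] and [I_sub_K]. *)
Let I := (H + L1)%VS.

Let memH x : x \in H = (x \in L0) && (diag_adN x == 0).
Proof. by rewrite memv_cap memv_ker. Qed.

Let H_br x y : x \in L0 -> y \in L0 -> ls_br x y \in H.
Proof.
move=> Lx Ly; rewrite memH diag_adN_br // eqxx andbT.
exact: (ls_br_grade Lx Ly).
Qed.

Let I_even x : x \in I -> x \in L0 -> x \in H.
Proof.
move=> /memv_addP[h Hh [y Ly ->]] Lhy; suff -> : y = 0 by rewrite addr0.
apply: grade_disjoint => //; rewrite -(addKr h y) rpredD // rpredN.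
by move: Hh; rewrite memH => /andP[].
Qed.

Let ideal_I : ideal I.
Proof.
split.
  apply: graded_intro => _ /memv_addP[h Hh [y Ly ->]]; exists h, y; split=> //.
  - by rewrite -[h]addr0 memv_add ?mem0v.
  - by move: Hh; rewrite memH => /andP[].
  - by rewrite -[y]add0r memv_add ?mem0v.
apply/brvP=> _ z /memv_addP[h Hh [y Ly ->]] _.
have [z0 [z1 [Lz0 Lz1 ->]]] := homogeneous_split z.
have Lh : h \in L0 by move: Hh; rewrite memH => /andP[].
have I0 v : v \in H -> v \in I by move=> ?; rewrite -[v]addr0 memv_add ?mem0v.
have I1 v : v \in L1 -> v \in I by move=> ?; rewrite -[v]add0r memv_add ?mem0v.
rewrite !(brDl, brDr) !rpredD //.
- exact/I0/H_br.
- exact: (I1 _ (ls_br_grade Ly Lz0)).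
- exact: (I1 _ (ls_br_grade Lh Lz1)).
(* The analogue of Lie's theorem enters here: it puts [[L1, L1]] inside [[L0, L0]], hence inside
   [H]. *)
apply: I0; have /brvP s00 : (brv L0 L0 <= H)%VS.
  by apply/brvP=> u v; apply: H_br.
have /subvP s11 := subv_trans lieL (introT (brvP _ _ _) s00).
by apply: s11; apply: memv_brv.
Qed.

Let sKI : (K <= I)%VS.
Proof.
apply/subvP=> x Kx; have [gK _] := idK.
have [x0 [x1 [K0 Lx0 K1 Lx1 ->]]] := graded_split gK Kx.
by apply: memv_add => //; rewrite memH Lx0 (nilpotent_diag_adN nilK idK) /=.
Qed.

(** If the next derived term of [I] lies in [K], the current one plus [K] satisfies the Engel
    hypotheses: its even elements lie in [H] and act strictly triangularly. It is then a nilpotent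
    ideal, so it lies in [K]. Solvability starts the descent. *)
Let I_sub_K : (I <= K)%VS.
Proof.
have down k : (derived_series I k.+1 <= K)%VS -> (derived_series I k <= K)%VS.
  move=> /brvP Dk; have idD := ideal_derived k ideal_I.
  have idA := ideal_add idD idK; apply: subv_trans (addvSl _ K) _.
  apply: maxK => //; apply: (engel_nilpotent idK nilK idA).
  - exact: addvSr.
  - apply/brvP=> _ _ /memv_addP[d Dd [n Kn ->]] /memv_addP[d' Dd' [n' Kn' ->]].
    rewrite !(brDl, brDr) !rpredD //;
      by [exact: Dk | exact: ideal_brr | exact: ideal_brl].
  move=> x Ax Lx; exists (\dim {:N}) => _ /memv_imgP[n _ ->].
  rewrite -iter_adN (below1_nilpotent eB) ?linear0 //.
  apply: (below1P eB); first exact/(der_below0 adT)/adN_der.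
  apply/eqP; rewrite -diag_adNE.
  suff: x \in H by rewrite memH => /andP[].
  apply: I_even => //; move: Ax; apply/subvP; rewrite subv_add sKI andbT.
  elim: k {Dk idD idA} => //= k; apply: subv_trans.
  apply: subv_trans (proj2 (ideal_derived k ideal_I)).
  by apply: brvS; rewrite ?subvf.
have [k Dk] := solL.
have : (derived_series I k <= K)%VS.
  have := derived_seriesS k (subvf I); rewrite Dk => sD.
  exact: subv_trans sD (sub0v _).
by elim: k {Dk} => // k IHk /down/IHk.
Qed.

Lemma odd_in_nilradical : (L1 <= K)%VS.
Proof. exact: subv_trans (addvSr H L1) I_sub_K. Qed.

Lemma even_in_nilradical x : x \in L0 -> (x \in K) = (diag_adN x == 0).
Proof.
move=> Lx; apply/idP/eqP => [Kx|dx]; first exact: nilpotent_diag_adN Kx Lx.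
apply: (subvP I_sub_K); rewrite -[x]addr0 memv_add ?mem0v //.
by rewrite memH Lx dx eqxx.
Qed.

Lemma br_even_in_nilradical x y : x \in L0 -> y \in L0 -> ls_br x y \in K.
Proof.
move=> Lx Ly; rewrite even_in_nilradical ?diag_adN_br //.
exact: (ls_br_grade Lx Ly).
Qed.

Lemma nilradical_even_full : (K + L0)%VS = fullv.
Proof.
apply/eqP; rewrite eqEsubv subvf -(ls_gradeD L) subv_add addvSr /=.
exact: subv_trans odd_in_nilradical (addvSl _ _).
Qed.

Lemma dim_codim_nilradical :
  \dim {:L} = (\dim K + \dim (diag_adN @: L0))%N.
Proof.
have := dimv_sum_cap K L0; rewrite nilradical_even_full.
have -> : (K :&: L0 = L0 :&: lker diag_adN)%VS.
  apply/vspaceP=> x; rewrite !memv_cap memv_ker andbC.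
  by case Lx: (x \in L0); rewrite //= even_in_nilradical.
have := limg_ker_dim diag_adN L0; lia.
Qed.

Lemma diag_adN_img : (diag_adN @: L0 <= T)%VS.
Proof. by apply/subvP=> _ /memv_imgP[x Lx ->]; apply: diag_adN_torus. Qed.

End Solvable.
End Extension.

(** * Splitting off a Cartan subalgebra *)

Section Isomorphism.
Context {F : numClosedFieldType} {N : lieSuperalgebra F}.
Variables (L : lieSuperalgebra F) (iota : 'Hom(N, L)).
Hypotheses (iota_hom : ls_hom iota) (iota_inj : lker iota = 0%VS).
Variables (e : (\dim {:N}).-tuple N) (T : {vspace 'End(N)}) (t0 : 'End(N)).
Hypotheses (torT : torus T) (adT : adapted e T t0).
Hypotheses (nrK : nilradical (limg iota))
  (solL : solvable_ls L) (lieL : lie_theorem_condition L).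
Implicit Types (x y c : L) (m n : N).

Local Notation K := (limg iota).
Local Notation L0 := (ls_grade L false).
Local Notation L1 := (ls_grade L true).
Local Notation D := (adN iota).
Local Notation phi := (diag_adN iota e).

Let eB : basis_of fullv e. Proof. by case: adT. Qed.
Let idK : ideal K. Proof. by case: nrK. Qed.
Let nilK : nilpotent_sub K. Proof. by case: nrK. Qed.
Let maxK J : ideal J -> nilpotent_sub J -> (J <= K)%VS.
Proof. by case: nrK => _ _; apply. Qed.
Let oddK : (L1 <= K)%VS.
Proof. exact: (odd_in_nilradical iota_hom iota_inj idK adT). Qed.
Let brK x y : x \in L0 -> y \in L0 -> ls_br x y \in K.
Proof. exact: (br_even_in_nilradical iota_hom iota_inj idK adT). Qed.
Let evenK x : x \in L0 -> (x \in K) = (phi x == 0).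
Proof. exact: (even_in_nilradical iota_hom iota_inj idK adT). Qed.

Let iotaK : cancel iota (iota^-1)%VF.
Proof. by apply: lker0_lfunK; rewrite iota_inj. Qed.
Let DE x n : iota (D x n) = ls_br (iota n) x.
Proof. exact: adNE. Qed.

Variable x0 : L.
Hypotheses (Lx0 : x0 \in L0) (phi_x0 : phi x0 = t0).
Hypothesis phi_surj : (phi @: L0 = T)%VS.

(* A Cartan subalgebra: [phi x0 = t0] has no zero eigenvalue on [N], so the   *)
(* centralizer of x0 in L_0 is a complement of [N], abelian because           *)
(* [L_0, L_0] lies in [N].                                                    *)
Let C := (L0 :&: lker (ad x0))%VS.

Let memC c : (c \in C) = (c \in L0) && (ls_br c x0 == 0).
Proof. by rewrite memv_cap memv_ker adE. Qed.

Let CL0 c : c \in C -> c \in L0. Proof. by rewrite memC => /andP[]. Qed.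

Let KC0 : (K :&: C)%VS = 0%VS.
Proof.
apply/eqP; rewrite -subv0; apply/subvP=> _ /memv_capP[/memv_imgP[n _ ->]].
rewrite memC memv0 -DE => /andP[_ /eqP Dn].
suff -> : n = 0 by rewrite linear0.
have D0 : lker (D x0) == 0%VS.
  have dD := adN_der iota_hom iota_inj idK Lx0.
  apply: (below0_inj eB) => [|i]; first exact: (der_below0 adT).
  have [_ _ _ _ /(_ i)] := adT; rewrite -phi_x0 (diag_adNE iota_inj idK adT).
  by rewrite (diagonal_part_coord eB) eqxx.
apply/eqP; rewrite -memv0 -(eqP D0) memv_ker; apply/eqP/(can_inj iotaK).
by rewrite Dn linear0.
Qed.

(** [ad x0] sends [L0] into the kernel of [phi], of codimension [\dim T] in [L0]; rank-nullity
    bounds its own kernel from below. *)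
Let dimC : (\dim T <= \dim C)%N.
Proof.
have sK : (ad x0 @: L0 <= L0 :&: lker phi)%VS.
  apply/subvP=> _ /memv_imgP[y Ly ->]; rewrite adE memv_cap memv_ker.
  have Lyx := ls_br_grade Ly Lx0; rewrite Lyx -evenK //; exact: brK.
rewrite -(leq_add2r (\dim (ad x0 @: L0))) limg_ker_dim.
by rewrite -(limg_ker_dim phi L0) phi_surj addnC leq_add2r dimvS.
Qed.

Let KC_full : (K + C)%VS = fullv.
Proof.
apply/eqP; rewrite eqEdim subvf /= dimv_disjoint_sum //.
rewrite (dim_codim_nilradical iota_hom iota_inj idK adT) // phi_surj.
by rewrite leq_add2l dimC.
Qed.

Let KC_split y : exists n c, c \in C /\ y = iota n + c.
Proof.
have : y \in (K + C)%VS by rewrite KC_full memvf.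
by case/memv_addP=> _ /memv_imgP[n _ ->] [c Cc ->]; exists n, c.
Qed.

(** The bracket lies in [K] and again centralizes [x0], and [K] meets [C] trivially. *)
Let C_abelian c c' : c \in C -> c' \in C -> ls_br c c' = 0.
Proof.
move=> Cc Cc'; apply/eqP; rewrite -memv0 -KC0 memv_cap brK ?CL0 //= memC.
move: Cc Cc'; rewrite !memC => /andP[Lc /eqP cx] /andP[Lc' /eqP c'x].
rewrite (ls_br_grade Lc Lc') ad_even_der // cx c'x br0l linear0 addr0.
exact: eqxx.
Qed.

Variable g : 'End(N).
Hypotheses (gA : automorphism g) (gD : (g \o D x0 = t0 \o g)%VF).

Let g0 : lker g == 0%VS. Proof. by case: gA. Qed.

Let E y : 'End(N) := (g \o D y \o g^-1)%VF.

Let Elin a x y : E (a *: x + y) = a *: E x + E y.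
Proof.
rewrite /E adN_lin // comp_lfunDr -comp_lfunZr comp_lfunDl -comp_lfunZl.
by [].
Qed.

Let E0 : E 0 = 0.
Proof. by rewrite -(linfunE Elin) linear0. Qed.

Let Eg y n : E y (g n) = g (D y n).
Proof. by rewrite !comp_lfunE lker0_lfunK. Qed.

(** [D c] commutes with [D x0], so its conjugate commutes with [t0]. *)
Let E_torus c : c \in C -> E c \in T.
Proof.
rewrite memC => /andP[Lc /eqP cx]; apply: (commuting_in_torus adT).
  by apply: automorphism_conj => //; apply: adN_der.
apply/lfunP=> n; rewrite -(lker0_lfunVK g0 n); set m := (g^-1)%VF n.
have gDE k : t0 (g k) = g (D x0 k).
  by have /lfunP/(_ k) := gD; rewrite !comp_lfunE.
rewrite [LHS]comp_lfunE [RHS]comp_lfunE gDE !Eg gDE; congr (g _).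
have := congr1 (fun f : 'End(N) => f m) (adN_br iota_inj idK Lc Lx0).
rewrite cx add_lfunE opp_lfunE !comp_lfunE => /eqP.
have -> : D 0 = 0.
  by apply/lfunP=> k; apply: (can_inj iotaK); rewrite DE zero_lfunE !linear0.
by rewrite zero_lfunE eq_sym subr_eq0 => /eqP->.
Qed.

Let E_inj c : c \in C -> E c = 0 -> c = 0.
Proof.
move=> Cc Ec; apply/eqP; rewrite -memv0 -KC0 memv_cap Cc andbT.
rewrite evenK ?CL0 // (diag_adNE iota_inj idK adT); apply/eqP.
have -> : D c = 0.
  apply/lfunP=> n; apply: (lker0P g0).
  by rewrite -Eg Ec !zero_lfunE linear0.
by apply: (lfun_basis_eq eB) => i j;
  rewrite (diagonal_part_coord eB) !zero_lfunE !linear0 mul0rn.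
Qed.

Let E_surj t : t \in T -> exists2 c, c \in C & E c = t.
Proof.
pose El := linfun E; have ElE y : El y = E y.
  by apply: linfunE => a u v; apply: Elin.
have ElC : (El @: C = T)%VS.
  apply/eqP; rewrite eqEdim limg_dim_eq ?dimC ?andbT.
    by apply/subvP=> _ /memv_imgP[c Cc ->]; rewrite ElE; apply: E_torus.
  apply/eqP; rewrite -subv0; apply/subvP=> c.
  rewrite memv_cap memv_ker ElE memv0 => /andP[Cc /eqP Ec].
  by rewrite (E_inj Cc Ec).
by rewrite -ElC => /memv_imgP[c Cc ->]; exists c; rewrite ?ElE.
Qed.

(** On [K] this is [g], and on [C] the conjugated action, a bijection onto [T]. *)
Let f := linfun (fun y => (g ((iota^-1)%VF (daddv_pi K C y)),
                           vsproj T (E (daddv_pi C K y))) : semidirect torT).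

Let fE n c : c \in C -> f (iota n + c) = (g n, vsproj T (E c)).
Proof.
move=> Cc; rewrite linfunE => [|a u v]; last first.
  rewrite (linearP (daddv_pi C K)) Elin !linearP.
  by [].
have CK0 : (C :&: K)%VS = 0%VS by rewrite capvC.
have Kn : iota n \in K by rewrite memv_img ?memvf.
have p0 (U V : {vspace L}) v : (U :&: V)%VS = 0%VS -> v \in V ->
    daddv_pi U V v = 0.
  move=> UV0 Vv; have := daddv_pi_add UV0 (subvP (addvSr U V) _ Vv).
  by rewrite (daddv_pi_id _ Vv) 1?capvC // => /(canRL (addrK v)); rewrite subrr.
rewrite (linearD (daddv_pi K C)) (linearD (daddv_pi C K)) /=.
rewrite (daddv_pi_id KC0 Kn) (p0 K C c) // (p0 C K (iota n)) //.
by rewrite (daddv_pi_id CK0 Cc) addr0 add0r iotaK.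
Qed.

Let f_hom : ls_hom f.
Proof.
split=> [b|y z].
  apply/subvP=> _ /memv_imgP[y Ly ->].
  suff [n [c [Ln Cc cb ->]]] : exists n c, [/\ n \in ls_grade N b, c \in C,
      b -> c = 0 & y = iota n + c].
    rewrite fE //; apply/sd_gradeP; split=> [|/cb->] /=.
      exact: automorphism_grade.
    by rewrite E0 linear0.
  case: b Ly => Ly.
    have /memv_imgP[n _ en] := subvP oddK _ Ly.
    exists n, 0; split; rewrite ?mem0v ?addr0 //.
    by apply: (iota_grade_inv iota_hom iota_inj); rewrite -en.
  have [n [c [Cc ey]]] := KC_split y; exists n, c; split=> //.
  apply: (iota_grade_inv iota_hom iota_inj).
  by rewrite -(addrK c (iota n)) -ey rpredB // CL0.
have [n [c [Cc ->]]] := KC_split y; have [m [c' [Cc' ->]]] := KC_split z.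
have [_ iD] := iota_hom; have [[_ gM] _] := gA.
have -> : ls_br (iota n + c) (iota m + c') =
    iota (ls_br n m + D c' n - D c m) + 0.
  have cm : ls_br c (iota m) = - iota (D c m).
    by rewrite DE (br_evenC _ (CL0 Cc)) opprK.
  rewrite brDl [ls_br (iota n) _]brDr [ls_br c _]brDr cm.
  rewrite (C_abelian Cc Cc') !addr0.
  by rewrite linearB linearD /= iD !DE.
rewrite !fE ?mem0v // E0 linear0; congr pair.
rewrite /= linearB linearD /= gM !vsprojK ?E_torus // !Eg.
by [].
Qed.

Lemma extension_isomorphic : isomorphic L (semidirect torT).
Proof.
exists f; split; first exact: f_hom.
  apply/eqP; rewrite -subv0; apply/subvP=> y; rewrite memv_ker memv0.
  have [n [c [Cc ->]]] := KC_split y; rewrite fE // => /eqP[gn /= Ec].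
  have -> : n = 0 by apply: (lker0P g0); rewrite gn linear0.
  rewrite (E_inj Cc) ?linear0 ?addr0 //.
  by rewrite -(vsprojK (E_torus Cc)) Ec linear0.
apply/eqP; rewrite eqEsubv subvf /=; apply/subvP=> -[n t] _.
have [c Cc Ec] := E_surj (subvsP t).
have -> : (n, t) = f (iota ((g^-1)%VF n) + c) :> semidirect torT.
  by rewrite fE // lker0_lfunVK // Ec vsvalK.
by rewrite memv_img ?memvf.
Qed.

End Isomorphism.

(** * The semidirect product *)

Section SemidirectExtension.
Context {F : numClosedFieldType} {N : lieSuperalgebra F}.
Variables (e : (\dim {:N}).-tuple N) (T : {vspace 'End(N)}) (t0 : 'End(N)).
Hypotheses (torT : torus T) (adT : adapted e T t0).
Hypotheses (nilN : nilpotent_ls N) (ncN : ~ characteristically_nilpotent N).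

Local Notation M := (semidirect torT).

Let eB : basis_of fullv e. Proof. by case: adT. Qed.

Definition sd_iota : 'Hom(N, M) := linfun (fun n : N => (n, 0) : M).

Definition sd_complement : {vspace M} :=
  limg (linfun (fun t : subvs_of T => (0, t) : M)).

Lemma sd_iotaE n : sd_iota n = (n, 0).
Proof. exact: (linfunE (@sd_inl_linear _ _ T)). Qed.

Let inrE t : linfun (fun t : subvs_of T => (0, t) : M) t = (0, t).
Proof. exact: (linfunE (@sd_inr_linear _ _ T)). Qed.

Lemma sd_iota_inj : lker sd_iota = 0%VS.
Proof. by apply/eqP/lker0P=> n m; rewrite !sd_iotaE => -[]. Qed.

Lemma mem_sd_iota (x : M) : x \in limg sd_iota <-> x.2 = 0.
Proof.
split=> [/memv_imgP[n _ ->]|]; first by rewrite sd_iotaE.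
by case: x => n t /= ->; rewrite -sd_iotaE memv_img ?memvf.
Qed.

Lemma sd_iota_hom : ls_hom sd_iota.
Proof.
split=> [b|n m].
  by apply/subvP=> _ /memv_imgP[n Ln ->]; rewrite sd_iotaE; apply/sd_gradeP.
by rewrite !sd_iotaE; congr pair; rewrite /= !zero_lfunE addr0 subr0.
Qed.

Lemma sd_iota_ideal : ideal (limg sd_iota).
Proof.
split; last by apply/brvP=> x y _ _; apply/mem_sd_iota.
apply: graded_intro => _ /memv_imgP[n _ ->].
have [n0 [n1 [L0 L1 ->]]] := homogeneous_split n.
exists (sd_iota n0), (sd_iota n1); rewrite linearD.
by split; rewrite ?memv_img ?memvf // sd_iotaE; apply/sd_gradeP.
Qed.

Lemma sd_iota_nilpotent : nilpotent_sub (limg sd_iota).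
Proof.
have [k Nk] := nilN; exists k; apply/eqP; rewrite -subv0.
have lowK j : (lower_central (limg sd_iota) j <=
    sd_iota @: lower_central fullv j)%VS.
  elim: j => [|j /subvP IHj]; first exact: subvv.
  rewrite [lower_central _ _]/=; apply/brvP=> u v /IHj/memv_imgP[n Nn ->].
  case/memv_imgP=> m _ ->; have [_ <-] := sd_iota_hom.
  by rewrite memv_img // memv_brv ?memvf.
by apply: subv_trans (lowK k) _; rewrite Nk limg0.
Qed.

(** Odd elements have no component in [T]. An even [(n, t)] in a nilpotent ideal acts on [N] with
    zero diagonal; this diagonal is [t]. *)
Lemma sd_iota_max (J : {vspace M}) :
  ideal J -> nilpotent_sub J -> (J <= limg sd_iota)%VS.
Proof.
move=> idJ nJ; apply/subvP=> x Jx; have [gJ _] := idJ.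
have [x0 [x1 [J0 L0 J1 L1 ->]]] := graded_split gJ Jx.
apply/mem_sd_iota; have /sd_gradeP[_ /(_ isT) /= ->] := L1; rewrite addr0.
case: x0 J0 L0 => n t Jnt Lnt /=.
have := nilpotent_diag_adN sd_iota_hom sd_iota_inj sd_iota_ideal adT nJ idJ
  Jnt Lnt.
have -> : (n, t) = sd_iota n + (0, t) :> M.
  by rewrite sd_iotaE; congr pair; rewrite /= ?addr0 ?add0r.
rewrite linearD /=.
rewrite (nilpotent_diag_adN sd_iota_hom sd_iota_inj sd_iota_ideal adT
  sd_iota_nilpotent sd_iota_ideal); first last.
- by rewrite sd_iotaE; apply/sd_gradeP; case/sd_gradeP: Lnt.
- by rewrite memv_img ?memvf.
rewrite add0r (diag_adNE sd_iota_inj sd_iota_ideal adT).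
have -> : adN sd_iota ((0, t) : M) = vsval t.
  apply/lfunP=> m; apply: (lker0P (introT eqP sd_iota_inj)).
  rewrite (adNE sd_iota_ideal) !sd_iotaE; congr pair.
  by rewrite /= linear0 zero_lfunE add0r subr0.
rewrite (diagonal_part_id eB); last exact/(torus_diagonal adT)/subvsP.
by move=> t0'; apply/val_inj; rewrite /= t0'.
Qed.

Lemma sd_nilradical : nilradical (limg sd_iota).
Proof.
split; first exact: sd_iota_ideal.
  exact: sd_iota_nilpotent.
exact: sd_iota_max.
Qed.

Lemma sd_solvable : solvable_ls M.
Proof.
have [k Kk] := sd_iota_nilpotent; exists k.+1; apply/eqP; rewrite -subv0 -Kk.
apply: subv_trans (derived_lower k _); last first.
  apply: subv_trans (proj2 sd_iota_ideal); exact: brvS (subvv _) (subvf _).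
elim: k {Kk} => [|k IHk]; last exact: brvS.
by apply/brvP=> x y _ _; apply/mem_sd_iota.
Qed.

(** Otherwise the whole algebra equals [N] and [t0 = 0]; since [t0] has no zero eigenvalue, [N = 0],
    which is characteristically nilpotent. *)
Lemma sd_not_nilpotent : ~ nilpotent_ls M.
Proof.
move=> nM; have Tt0 : t0 \in T by case: adT => _ _ [].
have := subvP (sd_iota_max (ideal_full (L := M)) nM) (0, vsproj T t0) (memvf _).
move/mem_sd_iota => /= /(congr1 vsval); rewrite vsprojK // => t00.
apply: ncN => d _; exists 0%N => x /=; apply: (coord_eq eB) => i.
by have [_ _ _ _ /(_ i)] := adT; rewrite t00 zero_lfunE linear0 eqxx.
Qed.

(** [t0] is bijective on the even part of [N], so a bracket of odd elements is [t0 w = [w, t0]] with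
    [w] even. *)
Lemma sd_lie : lie_theorem_condition M.
Proof.
have Tt0 : t0 \in T by case: adT => _ _ [].
have t0d := torus_der torT Tt0.
have t0_inj : lker t0 == 0%VS.
  by apply: (below0_inj eB); [apply: (der_below0 adT) | case: adT].
have t0N : (t0 @: ls_grade N false = ls_grade N false)%VS.
  apply/eqP; rewrite eqEdim limg_dim_eq ?leqnn ?(eqP t0_inj) ?capv0 // andbT.
  by case: t0d.
apply/brvP=> -[n s] [m t] /sd_gradeP[/= Ln /(_ isT) ->].
case/sd_gradeP=> /= Lm /(_ isT) ->.
have : ls_br n m \in ls_grade N false := ls_br_grade Ln Lm.
rewrite -t0N => /memv_imgP[w Lw ew].
have nm : ls_br ((n, 0) : M) (m, 0) = ls_br ((w, 0) : M) (0, vsproj T t0).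
  congr pair; rewrite /= !zero_lfunE ew vsprojK // !linear0.
  by rewrite add0r !addr0.
rewrite [X in X \in _]nm.
apply: (@memv_brv _ M (ls_grade M false) (ls_grade M false));
  by apply/sd_gradeP; rewrite ?mem0v.
Qed.

Lemma sd_extension : solvable_extension sd_iota sd_complement.
Proof.
split; [split | split | exact: sd_nilradical | split].
- exact: sd_solvable.
- exact: sd_not_nilpotent.
- exact: sd_lie.
- exact: sd_iota_hom.
- exact: sd_iota_inj.
- apply/eqP; rewrite eqEsubv subvf; apply/subvP=> -[n t] _.
  have -> : (n, t) = sd_iota n + linfun (fun t : subvs_of T => (0, t) : M) t.
    by rewrite sd_iotaE inrE; congr pair; rewrite /= ?addr0 ?add0r.
  by rewrite memv_add ?memv_img ?memvf.
apply/eqP; rewrite -subv0; apply/subvP=> x.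
rewrite memv_cap => /andP[/mem_sd_iota + /memv_imgP[t _]].
by rewrite inrE => + ex; rewrite ex memv0 /= => ->.
Qed.

Lemma dim_sd_complement : \dim sd_complement = \dim T.
Proof.
rewrite limg_dim_eq ?dimvf //; apply/eqP; rewrite -subv0; apply/subvP=> t.
by rewrite memv_cap memv_ker inrE => /andP[_ /eqP[->]]; rewrite mem0v.
Qed.

(** * Comparison of an arbitrary extension with the semidirect product *)

Section Bound.
Variables (L : lieSuperalgebra F) (iota : 'Hom(N, L)) (Q : {vspace L}).
Hypothesis extQ : solvable_extension iota Q.

Lemma dim_extension :
  \dim Q = \dim (diag_adN iota e @: ls_grade L false).
Proof.
have [[sol _ lie] [hom inj] [idK nilK maxK] [KQ KQ0]] := extQ.
have := dim_codim_nilradical hom inj idK adT nilK maxK sol lie.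
by rewrite -KQ dimv_disjoint_sum // => /addnI.
Qed.

Lemma diag_adN_sub_torus : (diag_adN iota e @: ls_grade L false <= T)%VS.
Proof.
have [_ [hom inj] [idK _ _] _] := extQ.
exact: (diag_adN_img hom inj idK adT).
Qed.

Lemma dim_extension_le : (\dim Q <= \dim T)%N.
Proof. by rewrite dim_extension dimvS // diag_adN_sub_torus. Qed.

Lemma maximal_isomorphic : (\dim T <= \dim Q)%N -> isomorphic L M.
Proof.
move=> leTQ; have phiT : (diag_adN iota e @: ls_grade L false = T)%VS.
  by apply/eqP; rewrite eqEdim diag_adN_sub_torus -dim_extension.
have Tt0 : t0 \in T by case: adT => _ _ [].
have /memv_imgP[x Lx ex] :
  t0 \in (diag_adN iota e @: ls_grade L false)%VS by rewrite phiT.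
have [[sol _ lie] [hom inj] nr _] := extQ; have [idK _ _] := nr.
have [|g gA gD] := conj_to_torus torT adT (adN_der hom inj idK Lx).
  by rewrite -(diag_adNE inj idK adT).
exact: (extension_isomorphic hom inj torT adT nr sol lie Lx _ phiT gA gD).
Qed.

End Bound.

Lemma sd_maximal : maximal_solvable_extension N M.
Proof.
exists sd_iota, sd_complement; split; first exact: sd_extension.
by move=> R' iota' Q' ext'; rewrite dim_sd_complement (dim_extension_le ext').
Qed.

End SemidirectExtension.

Lemma isomorphic_refl (F : numClosedFieldType) (L : lieSuperalgebra F) :
  isomorphic L L.
Proof.
have [h k0] := @automorphism1 _ L.
by exists \1%VF; split; [| exact/eqP | rewrite lim1g].
Qed.

Theorem theorem4p1 (R : realType) (N : lieSuperalgebra R[i])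
    (N_nilpotent : nilpotent_ls N)
    (N_not_char_nilpotent : ~ characteristically_nilpotent N)
    (N_dlocdiag : d_locally_diagonalizable N) :
  exists M : lieSuperalgebra R[i],
    [/\ maximal_solvable_extension N M,
        forall M' : lieSuperalgebra R[i],
          maximal_solvable_extension N M' -> isomorphic M' M &
        exists (T : {vspace 'End(N)}) (hT : torus T),
          maximal_torus T /\ isomorphic M (semidirect hT)].
Proof.
have [e [T [t0 [maxT adT]]]] := adapted_exists N_not_char_nilpotent N_dlocdiag.
have [torT _] := maxT; exists (semidirect torT); split.
- exact: sd_maximal adT N_nilpotent N_not_char_nilpotent.
- move=> M' [iota [Q [extQ maxQ]]].
  apply: (maximal_isomorphic torT adT extQ).
  (* Maximality of [M'], tested against the semidirect product, gives the missing inequality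
     [\dim T <= \dim Q]. *)
  rewrite -(dim_sd_complement torT).
  apply: maxQ; exact: sd_extension adT N_nilpotent N_not_char_nilpotent.
- by exists T, torT; split; last exact: isomorphic_refl.
Qed.
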